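(* Let $X=(X_i)_{i\in\mathbb{Z}}$ be i.i.d. Rademacher random variables with $\mathbb{P}(X_i=1)=\mathbb{P}(X_i=-1)=1/2$, and set $\xi_i:=(X_i+1)/2$. For each $n\in\mathbb{N}$ let $(a^{(n)}_i)_{i\in\mathbb{Z}}$ be a summable double-sided sequence of real numbers, and define $$G_n:=\sum_{i\in\mathbb{Z}} a^{(n)}_i\,\xi_i\xi_{i+1},\qquad F_n:=\frac{G_n-\mathbb{E}[G_n]}{\sqrt{\operatorname{Var}(G_n)}},\qquad C_n:=\frac{\|a^{(n)}\|_{l^4(\mathbb{Z})}^2}{\operatorname{Var}(G_n)},$$ where $\|a\|_{l^p(\mathbb{Z})}=(\sum_{i\in\mathbb{Z}}|a_i|^p)^{1/p}$. Then there are constants $K,c>0$ depending only on the coefficient sequence $(a^{(n)}_i)_{i\in\mathbb{Z}}$ such that, with $$\gamma_n(z):=e^{c\,z\,(\operatorname{Var}(G_n))^{-1/2}}\Big(z^{1/2}C_n^{1/2}+(1+z^{1/2}+z)\,C_n\Big),$$ we have $$\Big|\frac{\mathbb{P}(F_n>z)}{1-\Phi(z)}-1\Big|\le K\,(1+z^2)\,\gamma_n(z)$$ for all $0\le z\le \min\{C_n^{-1/5},C_n^{-1/3},C_n^{-2/5},\operatorname{Var}(G_n)^{1/2}\}$ such that $(1+z^2)\gamma_n(z)\le 1$. Here $\Phi$ is the standard normal distribution function.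
   Context: $\operatorname{Var}(G_n)>0$ is implicitly assumed so that $F_n$ is defined. The paper writes the conclusion as $\frac{\mathbb{P}(F_n>z)}{1-\Phi(z)}=1+O(1)(1+z^2)\gamma_n(z)$ with $\gamma_n(z)=e^{O(1)z\operatorname{Var}(G_n)^{-1/2}}(\dots)$, where each $O(1)$ is bounded by a constant depending only on the coefficient sequence. *)

(* Defs.v *)
From HB Require Import structures.
From mathcomp Require Import all_boot all_order all_algebra.
From mathcomp Require Import all_classical all_reals all_analysis.
Set Implicit Arguments. Unset Strict Implicit. Unset Printing Implicit Defensive.
Import Order.TTheory GRing.Theory Num.Theory.
Import numFieldNormedType.Exports.
Local Open Scope classical_set_scope.
Local Open Scope ring_scope.

Section Defs.
Context {R : realType}.

Definition zsum (a : int -> R) : R :=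
  limn (fun N : nat => \sum_(i < N.*2.+1) a (i%:Z - N%:Z)).

Definition lpnormZ (p : R) (a : int -> R) : R :=
  (zsum (fun i => `|a i| `^ p)) `^ p^-1.

Definition Phi (z : R) : R := fine (normal_prob 0 1 `]-oo, z]).

Context {d} {T : measurableType d} (P : probability T R).

Definition mutually_independent (X : int -> T -> R) : Prop :=
  forall (s : seq int), uniq s ->
  forall (B : int -> set R), (forall i, measurable (B i)) ->
  fine (P (\big[setI/setT]_(i <- s) (X i @^-1` B i)))
  = \prod_(i <- s) fine (P (X i @^-1` B i)).

Definition iid_rademacher (X : int -> {RV P >-> R}) : Prop :=
  (forall i, P (X i @^-1` [set 1]) = (2^-1)%:E) /\
  (forall i, P (X i @^-1` [set -1]) = (2^-1)%:E) /\
  mutually_independent (fun i => (X i : T -> R)).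

Definition xi (X : int -> {RV P >-> R}) (i : int) (w : T) : R := (X i w + 1) / 2.

Definition Gsum (X : int -> {RV P >-> R}) (a : int -> R) (w : T) : R :=
  zsum (fun i => a i * xi X i w * xi X (i + 1) w).

Definition EG X a : R := fine ('E_P[Gsum X a])%E.
Definition VarG X a : R := fine ('V_P[Gsum X a])%E.

Definition Fnorm X a (w : T) : R := (Gsum X a w - EG X a) / Num.sqrt (VarG X a).

Definition Cn X a : R := (lpnormZ 4 a) ^+ 2 / VarG X a.

Definition gamma_n X a (c z : R) : R :=
  expR (c * z * (Num.sqrt (VarG X a))^-1) *
  (Num.sqrt z * Num.sqrt (Cn X a) + (1 + Num.sqrt z + z) * Cn X a).

End Defs.

(* Main.v *)
Require Import Defs.
From HB Require Import structures.
From mathcomp Require Import all_boot all_order all_algebra.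
From mathcomp Require Import all_classical all_reals all_analysis.
From mathcomp Require Import measurable_realfun ring lra zify.
Set Implicit Arguments. Unset Strict Implicit. Unset Printing Implicit Defensive.
Import Order.TTheory GRing.Theory Num.Theory.
Import numFieldNormedType.Exports.
Local Open Scope classical_set_scope.
Local Open Scope ring_scope.

(** The proof is Stein's method for functions of independent signs.  The centred
    sum is [W = \sum_k X_k V_k] with [V_k] independent of [X_k], so flipping the
    [k]-th sign gives the integration by parts [E(X_k V_k F) = E(V_k D_k F)].
    Applied to the solution [f] of the Stein equation for [1_{w <= z}], it
    leaves two errors: one from [T - E T], where [T = \sum_k V_k D_k W], and one
    from the first-order expansion of [D_k f(W)].  Because [w f(w)] is
    increasing, the latter is dominated by increments of a single function
    [psi], and a second integration by parts turns the sum of these increments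
    into [E(psi(W) S)].  Both [T - E T] and [S] are again sums [\sum_k X_k h_k]
    with small gradients, so that [E(|Y| exp(t W)) <= K eps (1 + t) exp(t^2/2)]
    for each of them; summing over the exponentials that dominate [f'] and
    [psi] gives a bound relative to [1 - Phi z].  The bi-infinite sum is reached
    through its partial sums, which are uniformly close to it almost surely. *)

(** The error has to be small relative to [1 - Phi z], itself possibly tiny, so uniform bounds on
    the Stein solution do not suffice. Left of [z] they are replaced by exponentials [exp (t w)]
    weighted by [exp (- t^2 / 2)]: the bound [exp (t^2 / 2)] on exponential moments cancels the
    weight exactly, and a polynomial factor remains for each of about [1 + z] values of [t]. These
    moments stay under control as long as [t^3 \sum_k beta_k^3] is bounded, which
    [(1 + z)^3 C_n <= 2] guarantees. The rate is [C_n] because everything reduces to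
    [\sum_k beta_k^4]: at unit variance, Cauchy-Schwarz bounds [\sum_k beta_k^3] by a multiple of
    its square root. The outcome is a relative error of order [(1 + z)^3 C_n] with an absolute
    constant, and [(1 + z)^3 <= 2 (1 + z^2) (1 + z)] places it below a multiple of
    [(1 + z^2) gamma_n(z)]. *)

(** * The Gaussian tail and the Stein equation *)

Section Gauss.
Context {R : realType}.
Implicit Types x w z : R.
Local Notation mu := (@lebesgue_measure R).

Definition phi x : R := normal_peak 1 * expR (- (x ^+ 2 / 2)).
Definition iphi x : R := (normal_peak 1)^-1 * expR (x ^+ 2 / 2).

Lemma normal_peak1_gt0 : 0 < normal_peak 1 :> R.
Proof. by apply: normal_peak_gt0; rewrite oner_eq0. Qed.

Lemma phi_gt0 x : 0 < phi x.
Proof. exact: mulr_gt0 normal_peak1_gt0 (expR_gt0 _). Qed.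

Lemma iphi_gt0 x : 0 < iphi x.
Proof. by apply: mulr_gt0 (expR_gt0 _); rewrite invr_gt0 normal_peak1_gt0. Qed.

Lemma phi_iphi x : phi x * iphi x = 1.
Proof.
rewrite /phi /iphi mulrACA divff ?gt_eqF ?normal_peak1_gt0// mul1r -expRD addrC subrr.
exact: expR0.
Qed.

Lemma normal_pdf_phi : normal_pdf 0 1 = phi.
Proof.
apply/funext => x; rewrite normal_pdfE ?oner_eq0// /normal_fun /phi.
by rewrite subr0 expr1n mulNr.
Qed.

Lemma Phi_Rintegral : Phi = (fun z => \int[mu]_(t in `]-oo, z]) phi t).
Proof. by apply/funext => z; rewrite /Phi /normal_prob normal_pdf_phi. Qed.

Lemma integrable_phi (A : set R) : measurable A ->
  mu.-integrable A (EFin \o phi).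
Proof.
move=> mA; apply: (@integrableS _ _ _ _ setT) => //.
by have := @integrable_normal_pdf R 0 1; rewrite normal_pdf_phi.
Qed.

Lemma is_derive_phi x : is_derive x 1 (phi : R -> R) (- x * phi x).
Proof.
rewrite /phi; apply: is_derive_eq; rewrite /GRing.scale/=.
set e := expR _; set p := normal_peak 1; lra.
Qed.

Lemma is_derive_iphi x : is_derive x 1 (iphi : R -> R) (x * iphi x).
Proof.
rewrite /iphi; apply: is_derive_eq; rewrite /GRing.scale/=.
set e := expR _; set p := (normal_peak 1)^-1; lra.
Qed.

Lemma continuous_phi : continuous phi.
Proof.
by rewrite -normal_pdf_phi; apply: continuous_normal_pdf; rewrite oner_eq0.
Qed.

Lemma is_derive_Phi x : is_derive x 1 (Phi : R -> R) (phi x).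
Proof.
have x1 : x < x + 1 by rewrite ltrDl.
have [dP eP] : derivable (Phi : R -> R) x 1 /\ derive1 (Phi : R -> R) x = phi x.
  rewrite Phi_Rintegral; apply: (continuous_FTC1 x1) => //.
  - exact: (@integrable_phi `]-oo, x + 1] (measurable_itv _)).
  - by rewrite ltNyr.
  - exact: continuous_phi.
by apply: (DeriveDef dP); rewrite -derive1E eP.
Qed.

Lemma Phi_ge0 x : 0 <= Phi x :> R.
Proof. by rewrite /Phi fine_ge0. Qed.

Lemma Phi_le1 x : Phi x <= 1 :> R.
Proof.
rewrite -lee_fin /Phi fineK ?fin_num_measure//.
exact: probability_le1.
Qed.

(** Under the normal law, the identity is a random variable with distribution function [Phi]; the
    limits of [Phi] at infinity are those of a cdf. *)
Let idR : measurableTypeR R -> R := idfun.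

#[local] HB.instance Definition _ :=
  @isMeasurableFun.Build _ _ _ _ idR (@measurable_id _ _ setT).

Lemma cvg_Phi_y : Phi x @[x --> +oo] --> (1 : R).
Proof.
have /fine_cvgP[_] :=
  @cvg_cdfy1 _ _ R (normal_prob 0 1) (idR : {RV normal_prob 0 1 >-> R}).
exact.
Qed.

Lemma cvg_Phi_Ny : Phi x @[x --> -oo] --> (0 : R).
Proof.
have /fine_cvgP[_] :=
  @cvg_cdfNy0 _ _ R (normal_prob 0 1) (idR : {RV normal_prob 0 1 >-> R}).
exact.
Qed.

Lemma is_derive_MVT (f df : R -> R) (a b : R) : a <= b ->
  (forall x, a <= x <= b -> is_derive x 1 f (df x)) ->
  exists2 c, a <= c <= b & f b - f a = df c * (b - a).
Proof.
move=> ab fdf; have [|x|c] := @MVT_segment R f df a b ab.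
- by move=> x; rewrite in_itv/= => /andP[? ?]; apply: fdf; rewrite !ltW.
- apply: derivable_within_continuous => y; rewrite in_itv/= => /fdf ?.
  exact: ex_derive.
- by rewrite in_itv/= => ? ?; exists c.
Qed.

Lemma is_derive_ndecr (f df : R -> R) (a b : R) : a <= b ->
  (forall x, a <= x <= b -> is_derive x 1 f (df x)) ->
  (forall x, a <= x <= b -> 0 <= df x) -> f a <= f b.
Proof.
move=> ab fdf df0; have [c cab e] := is_derive_MVT ab fdf.
by rewrite -subr_ge0 e mulr_ge0 ?df0// subr_ge0.
Qed.

Lemma is_derive_nincr (f df : R -> R) (a b : R) : a <= b ->
  (forall x, a <= x <= b -> is_derive x 1 f (df x)) ->
  (forall x, a <= x <= b -> df x <= 0) -> f b <= f a.
Proof.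
move=> ab fdf df0; have [c cab e] := is_derive_MVT ab fdf.
by rewrite -subr_le0 e mulr_le0_ge0 ?df0// subr_ge0.
Qed.

Lemma Phi_ndecr : {homo (Phi : R -> R) : x y / x <= y}.
Proof.
move=> x y xy; apply: (is_derive_ndecr xy) => t _; first exact: is_derive_Phi.
exact/ltW/phi_gt0.
Qed.

Lemma phi_le_peak x : phi x <= normal_peak 1.
Proof.
by rewrite /phi ger_pMr ?normal_peak1_gt0// expR_le1 oppr_le0 divr_ge0// sqr_ge0.
Qed.

(** Divided by [1 + x ^+ 2], the gap between the two sides is nonincreasing, and at [y > 0] it is at
    least [- (normal_peak 1 / y)]; it can therefore never be negative. *)
Lemma mills_lower x : x * phi x <= (1 + x ^+ 2) * (1 - Phi x).
Proof.
pose s (y : R) : R := 1 + y ^+ 2.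
have s0 y : 0 < s y by rewrite /s ltr_pwDl// sqr_ge0.
pose k (y : R) : R := (1 - Phi y) - y * phi y * (s y)^-1.
pose dk (y : R) : R := - 2 * phi y * (s y)^-1 ^+ 2.
have kdk (y : R) : is_derive y 1 (k : R -> R) (dk y).
  have h1 := is_derive_Phi y; have h2 := is_derive_phi y.
  have h3 : is_derive y 1 (s : R -> R) (2 * y).
    by rewrite /s; apply: is_derive_eq; rewrite /GRing.scale/=; lra.
  have h4 : is_derive y 1 ((fun t => (s t)^-1) : R -> R) (- (s y)^-1 ^+ 2 * (2 * y)).
    by apply: is_derive_eq; [apply: is_deriveV; rewrite gt_eqF | rewrite /GRing.scale/= exprVn].
  apply: is_derive_eq; rewrite /GRing.scale/= /dk.
  rewrite /s; field; by rewrite gt_eqF ?s0.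
have kdecr y : x <= y -> k y <= k x.
  move=> xy; apply: (@is_derive_nincr k dk x y xy) => t _.
  by rewrite /dk -mulrA mulNr oppr_le0 mulr_ge0// mulr_ge0 ?sqr_ge0// ltW// phi_gt0.
have k_ge y : 0 < y -> - (normal_peak 1 / y) <= k y.
  move=> y0; rewrite /k lerBrDr (@le_trans _ _ 0)//; last by rewrite subr_ge0 Phi_le1.
  rewrite addrC subr_le0 mulrAC [leRHS]mulrC; apply: ler_pM.
  - by rewrite divr_ge0 ?ltW ?s0.
  - exact/ltW/phi_gt0.
  - by rewrite ler_pdivrMr ?s0// mulrC ler_pdivlMr// /s; nra.
  - exact: phi_le_peak.
have k0 : 0 <= k x.
  rewrite leNgt; apply/negP => kx0.
  (* At this [y] the lower bound [k_ge] is at least [k x / 2], strictly above [k x], whereas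
     [k y <= k x]. *)
  pose y := Num.max (x : R) (Num.max 1 (2 * normal_peak 1 / - k x)).
  have xy : x <= y by rewrite /y le_max lexx.
  have y1 : 1 <= y by rewrite /y !le_max lexx !orbT.
  have y0 : 0 < y by rewrite (lt_le_trans _ y1).
  have yk : 2 * normal_peak 1 / - k x <= y by rewrite /y !le_max lexx !orbT.
  move: yk; rewrite ler_pdivrMr ?oppr_gt0// => yk.
  have := le_trans (k_ge y y0) (kdecr y xy).
  rewrite lerNl ler_pdivlMr// => h; have := @normal_peak1_gt0; nra.
by move: k0; rewrite /k subr_ge0 ler_pdivrMr ?s0 /s 1?[X in _ <= X]mulrC.
Qed.

(** [phi y / y + Phi y] is nonincreasing for [y > 0] and dominates [Phi y], which tends to 1. *)
Lemma mills_upper x : 0 < x -> x * (1 - Phi x) <= phi x.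
Proof.
move=> x0.
pose k (y : R) : R := phi y * y^-1 + (Phi y : R).
pose dk (y : R) : R := - phi y * y^-1 ^+ 2.
have kdk (y : R) : x <= y -> is_derive y 1 (k : R -> R) (dk y).
  move=> xy; have y0 : y != 0 by rewrite gt_eqF// (lt_le_trans x0).
  have h1 := is_derive_Phi y; have h2 := is_derive_phi y.
  have h4 : is_derive y 1 ((fun t : R => t^-1) : R -> R) (- y^-1 ^+ 2).
    by apply: is_derive_eq; [apply: is_deriveV | rewrite /GRing.scale/= exprVn mulr1].
  apply: is_derive_eq; rewrite /GRing.scale/= /dk.
  by field.
have kdecr y : x <= y -> k y <= k x.
  move=> xy; apply: (@is_derive_nincr k dk x y xy) => t /andP[xt _]; first exact: kdk.
  by rewrite /dk mulNr oppr_le0 mulr_ge0 ?sqr_ge0// ltW// phi_gt0.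
have k0 : 1 <= k x.
  apply: (cvgr_to_le cvg_Phi_y).
  near=> y; have xy : x <= y by near: y; apply: nbhs_pinfty_ge; exact: num_real.
  apply: le_trans (kdecr y xy); rewrite /k lerDr divr_ge0// ltW ?phi_gt0//.
have : 1 - Phi x <= phi x / x by move: k0; rewrite /k; lra.
by rewrite ler_pdivlMr// mulrC.
Unshelve. all: end_near. Qed.

(** [Phi y + Phi (- y)] has zero derivative, and its constant value is read off at infinity. *)
Lemma PhiN x : Phi (- x) = 1 - Phi x.
Proof.
pose k (y : R) : R := Phi y + Phi (- y).
have kdk (y : R) : is_derive y 1 (k : R -> R) 0.
  have h1 := is_derive_Phi y; have h2 := is_derive_Phi (- y).
  have h3 : is_derive y 1 ((fun t => Phi (- t)) : R -> R) (- phi y).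
    have -> : - phi y = phi (- y) * (-1) by rewrite /phi sqrrN mulrN1.
    by apply: is_derive1_comp; apply: is_derive_eq.
  by apply: is_derive_eq; rewrite subrr.
have kx : k y @[y --> +oo] --> (1 + 0 : R).
  apply: cvgD; first exact: cvg_Phi_y.
  have := cvg_Phi_Ny; rewrite cvgNy_compNP; exact.
have kx1 : k y @[y --> +oo] --> k x.
  have -> : k = fun=> k x.
    by apply/funext => y; apply: is_derive_0_is_cst.
  exact: cvg_cst.
have e : (1 + 0 : R) = k x := cvg_unique (@Rhausdorff R) kx kx1.
by move: e; rewrite /k addr0 => ->; rewrite addrC addKr.
Qed.

(* The bounded solution of [f' w - w f w = 1_{w <= z} - Phi z]; [iphi] is the
   inverse of the density [phi]. *)
Definition steinf z w : R :=
  if w <= z then Phi w * iphi w * (1 - Phi z) else Phi z * ((1 - Phi w) * iphi w).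
Definition steing z w : R := w * steinf z w.
Definition dsteinf z w : R := steing z w + (w <= z)%R%:R - Phi z.

(** The Mills ratios of the left and right tails: on each side of [z] the Stein solution is a
    constant multiple of one of them. *)
Let lmills w : R := Phi w * iphi w.
Let umills w : R := (1 - Phi w) * iphi w.

Lemma lmills_ge0 w : 0 <= lmills w.
Proof. by rewrite mulr_ge0 ?Phi_ge0// ltW ?iphi_gt0. Qed.

Lemma umills_ge0 w : 0 <= umills w.
Proof. by rewrite mulr_ge0 ?subr_ge0 ?Phi_le1// ltW ?iphi_gt0. Qed.

Lemma is_derive_lmills w : is_derive w 1 (lmills : R -> R) (1 + w * lmills w).
Proof.
have h1 := is_derive_Phi w; have h2 := is_derive_iphi w.
have e := phi_iphi w; apply: is_derive_eq; rewrite /GRing.scale/= /lmills; lra.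
Qed.

Lemma is_derive_umills w : is_derive w 1 (umills : R -> R) (- 1 + w * umills w).
Proof.
have h1 := is_derive_Phi w; have h2 := is_derive_iphi w.
have e := phi_iphi w; apply: is_derive_eq; rewrite /GRing.scale/= /umills; lra.
Qed.

(** The right-hand side is the derivative of [w * lmills w], so this is the monotonicity of [steing]
    left of [z]. It is [mills_lower] reflected at the origin. *)
Lemma lmills_lower w : 0 <= (1 + w ^+ 2) * lmills w + w.
Proof.
have := mills_lower (- w); rewrite PhiN /phi sqrrN -/(phi w) opprB addrCA subrr addr0.
move=> h; have := phi_iphi w; have := iphi_gt0 w; rewrite /lmills => i0 e.
have : - w * phi w * iphi w <= (1 + w ^+ 2) * Phi w * iphi w by rewrite ler_pM2r.
rewrite -[X in X <= _]mulrA e; lra.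
Qed.

Lemma umills_lower w : 0 <= (1 + w ^+ 2) * umills w - w.
Proof.
have h := mills_lower w; have e := phi_iphi w; have i0 := iphi_gt0 w.
have : w * phi w * iphi w <= (1 + w ^+ 2) * (1 - Phi w) * iphi w by rewrite ler_pM2r.
rewrite -[X in X <= _]mulrA e /umills; lra.
Qed.

Lemma umills_upper w : w * umills w <= 1.
Proof.
have e := phi_iphi w; have i0 := iphi_gt0 w.
have [w0|w0] := lerP w 0.
  by rewrite (@le_trans _ _ 0)// mulr_le0_ge0// umills_ge0.
rewrite -e /umills mulrA ler_pM2r//; exact: mills_upper.
Qed.

Lemma lmills_upper w : - w * lmills w <= 1.
Proof.
have := umills_upper (- w); rewrite /lmills /umills PhiN /iphi sqrrN opprB addrCA subrr addr0.
by [].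
Qed.

Section stein.
Variable z : R.

Lemma steinf_le w : w <= z -> steinf z w = lmills w * (1 - Phi z).
Proof. by rewrite /steinf => ->. Qed.

Lemma steinf_ge w : z <= w -> steinf z w = Phi z * umills w.
Proof.
rewrite /steinf le_eqVlt => /predU1P[<-|zw]; last by rewrite leNgt zw.
by rewrite lexx /umills; lra.
Qed.

(** Left of [z] the derivative of [steinf z] is [steing z + 1 - Phi z], which is monotone, so the
    mean value theorem brackets the increment by its endpoint values. *)
Lemma stein_incr_le a b : a <= b -> b <= z ->
  [/\ steing z a <= steing z b,
     (b - a) * (steing z a + 1 - Phi z) <= steinf z b - steinf z a &
     steinf z b - steinf z a <= (b - a) * (steing z b + 1 - Phi z)].
Proof.
move=> ab bz; have az := le_trans ab bz.
have p1 : 0 <= 1 - Phi z by rewrite subr_ge0 Phi_le1.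
have gmono x y : x <= y -> x * lmills x <= y * lmills y.
  move=> xy; apply: (@is_derive_ndecr (fun w => w * lmills w)
    (fun w => (1 + w ^+ 2) * lmills w + w) _ _ xy).
    move=> w _; have h := is_derive_lmills w; apply: is_derive_eq.
    by rewrite /GRing.scale/=; lra.
  by move=> w _; exact: lmills_lower.
rewrite /steing !steinf_le//.
have [|c /andP[ac cb] e] := @is_derive_MVT lmills (fun w => 1 + w * lmills w) _ _ ab.
  by move=> w _; exact: is_derive_lmills.
have g1 := gmono _ _ ac; have g2 := gmono _ _ cb; have g3 := gmono _ _ ab.
have ba : 0 <= b - a by rewrite subr_ge0.
have pba := mulr_ge0 p1 ba.
split; first by have := ler_wpM2l p1 g3; lra.
- rewrite -mulrBl e.
  have := ler_wpM2l pba g1; lra.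
- rewrite -mulrBl e.
  have := ler_wpM2l pba g2; lra.
Qed.

Lemma stein_incr_ge a b : a <= b -> z <= a ->
  [/\ steing z a <= steing z b,
     (b - a) * (steing z a - Phi z) <= steinf z b - steinf z a &
     steinf z b - steinf z a <= (b - a) * (steing z b - Phi z)].
Proof.
move=> ab az; have bz := le_trans az ab.
have p1 : 0 <= Phi z by exact: Phi_ge0.
have gmono x y : x <= y -> x * umills x <= y * umills y.
  move=> xy; apply: (@is_derive_ndecr (fun w => w * umills w)
    (fun w => (1 + w ^+ 2) * umills w - w) _ _ xy).
    move=> w _; have h := is_derive_umills w; apply: is_derive_eq.
    by rewrite /GRing.scale/=; lra.
  by move=> w _; exact: umills_lower.
rewrite /steing !steinf_ge//.
have [|c /andP[ac cb] e] := @is_derive_MVT umills (fun w => - 1 + w * umills w) _ _ ab.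
  by move=> w _; exact: is_derive_umills.
have g1 := gmono _ _ ac; have g2 := gmono _ _ cb; have g3 := gmono _ _ ab.
have ba : 0 <= b - a by rewrite subr_ge0.
have pba := mulr_ge0 p1 ba.
split; first by have := ler_wpM2l p1 g3; lra.
- rewrite -mulrBr e.
  have := ler_wpM2l pba g1; lra.
- rewrite -mulrBr e.
  have := ler_wpM2l pba g2; lra.
Qed.

(** Up to a constant, [dsteinf z] is [steing z] minus the indicator of [z < w]. With the sign of the
    indicator reversed, the sum is nondecreasing and its increments control those of both parts. *)
Definition steinpsi w : R := steing z w + (z < w)%R%:R.

Lemma dsteinfE w : dsteinf z w = steinpsi w - (z < w)%R%:R + (1 - (z < w)%R%:R) - Phi z.
Proof. by rewrite /dsteinf /steinpsi leNgt; case: (z < w) => /=; lra. Qed.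

Lemma stein_incr a b : a <= b ->
  [/\ steing z a <= steing z b,
     (b - a) * (steing z a + 1 - (z < b)%R%:R - Phi z) <= steinf z b - steinf z a &
     steinf z b - steinf z a <= (b - a) * (steing z b + 1 - (z < a)%R%:R - Phi z)].
Proof.
move=> ab; case: (ltP z a) => za; case: (ltP z b) => zb /=.
- by have [h1 h2 h3] := stein_incr_ge ab (ltW za); split => //; lra.
- by have := lt_le_trans za ab; rewrite ltNge zb.
(* Here [a <= z < b]: the one-sided estimates on [[a, z]] and [[z, b]] are added, and monotonicity
   of [steing z] moves its value at [z] to an endpoint. *)
- have [h1 h2 h3] := stein_incr_le za (lexx z).
  have [k1 k2 k3] := stein_incr_ge (ltW zb) (lexx z).
  split; [lra| |].
    have : (b - z) * (steing z a) <= (b - z) * steing z z.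
      by rewrite ler_wpM2l// subr_ge0 ltW.
    lra.
  have : (z - a) * (steing z z) <= (z - a) * steing z b.
    by rewrite ler_wpM2l// subr_ge0.
  lra.
- by have [h1 h2 h3] := stein_incr_le ab zb; split => //; lra.
Qed.

(* [dsteinf z] is the derivative of [steinf z] away from the kink at [z]; it equals
   [steing z], an increasing function, up to a jump.  Both facts together turn the
   remainder of a first-order expansion into an increment of [steinpsi]. *)
Lemma stein_remainder w v :
  `|steinf z w - steinf z v - (w - v) * dsteinf z w| <= (w - v) * (steinpsi w - steinpsi v).
Proof.
rewrite dsteinfE /steinpsi; case: (leP v w) => vw.
  have [h1 h2 h3] := stein_incr vw.
  have b0 : 0 <= w - v by rewrite subr_ge0.
  have : (w - v) * (z < v)%R%:R <= (w - v) * (z < w)%R%:R.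
    by rewrite ler_wpM2l// ler_nat; case: (ltP z v) => // /lt_le_trans ->.
  have := ler_wpM2l b0 h1.
  by rewrite ler_norml => *; apply/andP; split; lra.
have [h1 h2 h3] := stein_incr (ltW vw).
have b0 : 0 <= v - w by rewrite subr_ge0 ltW.
have : (v - w) * (z < w)%R%:R <= (v - w) * (z < v)%R%:R.
  by rewrite ler_wpM2l// ler_nat; case: (ltP z w) => // /lt_trans ->.
have := ler_wpM2l b0 h1.
by rewrite ler_norml => *; apply/andP; split; lra.
Qed.

End stein.

(** For [t >= 1], [mills_lower] applies because [1 + t^2 <= t (1 + t)]. Below 1 the tail is at least
    [1 - Phi 1 >= phi 1 / 2], the origin of [2 * iphi 1]. *)
Lemma gauss_tail_lower t : 0 <= t ->
  expR (- (t ^+ 2 / 2)) <= 2 * iphi 1 * (1 + t) * (1 - Phi t).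
Proof.
move=> t0; have p0 := @normal_peak1_gt0.
have i1 : (normal_peak 1 : R)^-1 <= iphi 1.
  have ip : 0 < (normal_peak 1 : R)^-1 by rewrite invr_gt0.
  by rewrite /iphi ler_pMr// -[leLHS]expR0 ler_expR divr_ge0// sqr_ge0.
have i0 := iphi_gt0 1.
have P0 : 0 <= 1 - Phi t by rewrite subr_ge0 Phi_le1.
have [t1|/ltW t1] := leP 1 t.
  have h : phi t <= (1 + t) * (1 - Phi t).
    have t0' : 0 < t by lra.
    rewrite -(ler_pM2l t0') (le_trans (mills_lower t))// mulrA ler_wpM2r//; nra.
  have -> : expR (- (t ^+ 2 / 2)) = (normal_peak 1)^-1 * phi t.
    by rewrite /phi mulKf// gt_eqF.
  rewrite -mulrA; apply: ler_pM => //; [by rewrite invr_ge0 ltW|exact/ltW/phi_gt0|lra].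
have h : phi 1 <= 2 * (1 - Phi t).
  have := mills_lower 1; have := Phi_ndecr t1; rewrite expr1n; lra.
have : 1 <= iphi 1 * (2 * (1 - Phi t)).
  by rewrite -[leLHS](phi_iphi 1) mulrC ler_pM2l.
have : expR (- (t ^+ 2 / 2)) <= 1 by rewrite expR_le1 oppr_le0 divr_ge0// sqr_ge0.
have := mulr_ge0 (mulr_ge0 (ltW i0) t0) P0.
lra.
Qed.

Lemma gauss_tail_lower_max z :
  expR (- (Num.max z 0 ^+ 2 / 2)) <= 2 * iphi 1 * (1 + Num.max z 0) * (1 - Phi z).
Proof.
have [z0|/ltW z0] := leP 0 z; first exact: gauss_tail_lower.
apply: le_trans (gauss_tail_lower (lexx 0)) _.
have := Phi_ndecr z0; have := iphi_gt0 1 => i0 h.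
by rewrite ler_wpM2l; [|rewrite addr0 mulr1 mulr_ge0// ltW|lra].
Qed.

Lemma Phi_lt1 z : Phi z < 1.
Proof.
rewrite -subr_gt0 lt_neqAle subr_ge0 Phi_le1 andbT eq_sym.
apply/eqP => e; have := gauss_tail_lower_max z.
by rewrite e mulr0 leNgt expR_gt0.
Qed.

(* On [0 < w <= z], [w * exp (w^2 / 2)] is at most [exp (1 / 2)] times the term
   of the sum with [j = floor w]; beyond [z], the last summand exceeds a constant because
   [w >= z].  Only exponentials [exp (t w)] with [t <= 1 + max z 0] occur. *)
Definition stein_dom z w : R := (1 - Phi z) *
  (1 + iphi 1 * \sum_(j < (Num.truncn (Num.max z 0)).+1)
     j.+1%:R * expR (- (j.+1%:R ^+ 2 / 2)) * expR (j.+1%:R * w))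
  + (iphi 1 + 1) * expR (- Num.max z 0 ^+ 2) * expR (Num.max z 0 * w).

Lemma stein_dom_sum z w : 0 < w -> w <= z ->
  w * lmills w <= iphi 1 * \sum_(j < (Num.truncn (Num.max z 0)).+1)
     j.+1%:R * expR (- (j.+1%:R ^+ 2 / 2)) * expR (j.+1%:R * w).
Proof.
move=> w0 wz; have z0 : 0 <= z by rewrite (le_trans _ wz)// ltW.
rewrite max_l//.
have jN : (Num.truncn w < (Num.truncn z).+1)%N by rewrite ltnS le_truncn.
rewrite (bigD1 (Ordinal jN))//= mulrDr.
have /truncn_itv/andP[j1 j2] : 0 <= w by rewrite ltW.
set j := Num.truncn w in j1 j2 *.
apply: ler_wpDr.
  apply: mulr_ge0; [exact/ltW/iphi_gt0|apply: sumr_ge0 => i _].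
  by rewrite !mulr_ge0// ?expR_ge0.
have ip : 0 < (normal_peak 1 : R)^-1 by rewrite invr_gt0 normal_peak1_gt0.
apply: (@le_trans _ _ (w * iphi w)).
  by rewrite ler_pM2l// ger_pMl ?iphi_gt0// Phi_le1.
rewrite /iphi expr1n -!mulrA mulrCA ler_pM2l// [leRHS]mulrCA -!expRD.
have wj : w <= j.+1%:R by rewrite ltW.
apply: ler_pM; rewrite ?expR_ge0 ?ler_expR ?(ltW w0)//.
(* The exponents compare because [(j + 1 - w)^2 <= 1]. *)
rewrite -natr1 in j2 wj *; nra.
Qed.

(** Slightly negative [z] must be allowed: the thresholds used for finite blocks only converge to
    the given one, which may be 0. *)
Lemma stein_domP z w : - 1 <= z ->
  [/\ `|dsteinf z w| <= stein_dom z w, `|steing z w| <= stein_dom z w &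
     (z < w)%R%:R <= stein_dom z w].
Proof.
move=> z1; have p0 : 0 <= 1 - Phi z by rewrite subr_ge0 Phi_le1.
have p1 := Phi_ge0 z; have i1 := iphi_gt0 1.
rewrite /stein_dom; set S := \sum_(_ < _) _.
have S0 : 0 <= S.
  by rewrite sumr_ge0// => i _; rewrite !mulr_ge0// ?expR_ge0.
set E := _ * expR (_ * w).
have E0 : 0 <= E by rewrite /E !mulr_ge0 ?expR_ge0// addr_ge0// ltW.
have pS := mulr_ge0 p0 (mulr_ge0 (ltW i1) S0).
rewrite /dsteinf [in X in X - _](leNgt w z); case: (ltP z w) => /= [zw|wz].
  have hE : iphi 1 + 1 <= E.
    rewrite /E -mulrA -expRD; apply: ler_peMr; first by rewrite addr_ge0// ltW.
    rewrite -[leLHS]expR0 ler_expR; case: (leP 0 z) => z0; last by lra.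
    by have : 0 <= z * (w - z) by [rewrite mulr_ge0// subr_ge0 ltW|]; lra.
  suff : - iphi 1 <= steing z w <= 1.
    have := @Phi_le1 z; move=> p2 /andP[h1 h2].
    by split; rewrite ?ler_norml; try (apply/andP; split); lra.
  rewrite /steing (steinf_ge (ltW zw)) mulrCA.
  have [w0|/ltW w0] := leP 0 w.
    apply/andP; split; last first.
      by rewrite mulr_ile1 ?umills_upper ?Phi_le1// mulr_ge0// umills_ge0.
    have := mulr_ge0 p1 (mulr_ge0 w0 (umills_ge0 w)); lra.
  apply/andP; split; last first.
    by rewrite (@le_trans _ _ 0)// mulr_ge0_le0// mulr_le0_ge0// umills_ge0.
  (* Now [- 1 <= z < w <= 0], so [w ^+ 2 <= 1]. *)
  have Bi : umills w <= iphi 1.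
    rewrite /umills (@le_trans _ _ (iphi w))//.
      by rewrite ger_pMl ?iphi_gt0// gerBl Phi_ge0.
    have ip : 0 < (normal_peak 1 : R)^-1 by rewrite invr_gt0 normal_peak1_gt0.
    rewrite /iphi ler_pM2l// ler_expR ler_pM2r//; nra.
  have b0 := umills_ge0 w; have w1 : 0 <= - w by lra.
  have h1 : - w * umills w <= iphi 1 by nra.
  have h2 := mulr_ge0 w1 b0; have := @Phi_le1 z; nra.
rewrite /steing steinf_le//.
have [w0|w0] := leP w 0.
  have h1 := lmills_upper w; have h2 : w * lmills w <= 0 by rewrite mulr_le0_ge0// lmills_ge0.
  have := ler_wpM2l p0 h1; have := ler_wpM2l p0 h2.
  by rewrite !ler_norml => *; split; try (apply/andP; split); lra.
have h1 := stein_dom_sum w0 wz; have h2 : 0 <= w * lmills w by rewrite mulr_ge0 ?lmills_ge0// ltW.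
rewrite -/S in h1.
have := ler_wpM2l p0 h1; have := ler_wpM2l p0 h2.
by rewrite !ler_norml => *; split; try (apply/andP; split); lra.
Qed.
End Gauss.

(** * Stein's method on a finite space with sign flips *)

Section ExpTaylor.
Context {R : realType}.
Implicit Types x B : R.

(** With [x = t * X_k * D_k W], the quantity on the left is the relative change of [exp (t W)] under
    one flip, see [flipD_expE]. *)
Lemma expR_sub1_le x B : `|x| <= B -> `|(1 - expR (- (2 * x))) / 2| <= expR (2 * B) * `|x|.
Proof.
move=> xB; have := xB; rewrite ler_norml => /andP[x1 x2].
have B0 : 0 <= B by rewrite (le_trans _ xB).
have e1 : 1 <= expR (2 * B) by rewrite -[leLHS]expR0 ler_expR; lra.
have h1 := expR_ge1Dx (- (2 * x)); have h2 := expR_ge1Dx (2 * x).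
have e0 := expR_gt0 (2 * B); have ex0 := expR_gt0 (- (2 * x)).
have e3 : expR (- (2 * x)) * expR (2 * x) = 1 by rewrite -expRD addNr expR0.
have h4 : expR (- (2 * x)) <= expR (2 * B) by rewrite ler_expR; lra.
have h5 : expR (- (2 * x)) - 1 <= - (2 * x) * expR (- (2 * x)).
  by have := ler_wpM2l (ltW ex0) h2; rewrite e3; lra.
have [x0|/ltW x0] := leP 0 x; rewrite ler_norml ?(ger0_norm x0) ?(ler0_norm x0).
  have := ler_wpM2r x0 e1; have := mulr_ge0 x0 (ltW ex0); have := ler_wpM2r x0 h4.
  by move=> *; apply/andP; split; nra.
have x0' : 0 <= - x by lra.
have := ler_wpM2r x0' e1; have := ler_wpM2r x0' h4.
by move=> *; apply/andP; split; nra.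
Qed.

Lemma expR_sub1_taylor x B : `|x| <= B ->
  `|(1 - expR (- (2 * x))) / 2 - x| <= 2 * expR (2 * B) * x ^+ 2.
Proof.
move=> xB; have := xB; rewrite ler_norml => /andP[x1 x2].
have B0 : 0 <= B by rewrite (le_trans _ xB).
have h1 := expR_ge1Dx (- (2 * x)).
have := expR_sub1_le xB; set d := (1 - _) / 2 => hd.
have dx : d <= x by rewrite /d; lra.
have h2 := expR_ge1Dx (2 * x).
have ex0 := expR_gt0 (- (2 * x)).
have e3 : expR (- (2 * x)) * expR (2 * x) = 1 by rewrite -expRD addNr expR0.
have h5 : expR (- (2 * x)) - 1 <= - (2 * x) * expR (- (2 * x)).
  by have := ler_wpM2l (ltW ex0) h2; rewrite e3; lra.
(* This is [exp (- 2 x) (1 + 2 x) <= 1] rewritten; the first-order bound on [d] then makes the error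
   quadratic. *)
have h6 : x - d <= 2 * x * d by rewrite /d; nra.
have h7 : x * d <= expR (2 * B) * x ^+ 2.
  apply: le_trans (ler_norm _) _; rewrite normrM -(real_normK (num_real x)).
  by have := ler_wpM2l (normr_ge0 x) hd; rewrite expr2; lra.
rewrite ler_norml; apply/andP; split; first by lra.
have := sqr_ge0 x; have := expR_gt0 (2 * B); nra.
Qed.
End ExpTaylor.

Lemma is_derive_bigsum {R : realType} (J : Type) (r : seq J) (f df : J -> R -> R) (x : R) :
  (forall j, is_derive x 1 (f j) (df j x)) ->
  is_derive x 1 (fun y => \sum_(j <- r) f j y) (\sum_(j <- r) df j x).
Proof.
move=> fdf; elim: r => [|j r IH].
  under eq_fun do rewrite big_nil.
  by rewrite big_nil; exact: is_derive_cst.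
under eq_fun do rewrite big_cons.
by rewrite big_cons; exact: is_deriveD.
Qed.

Section Flip.
Context {R : realType} (Om I : finType) (o0 : Om).
Variables (flip : I -> Om -> Om) (X : I -> Om -> R).
Hypothesis flipK : forall k, involutive (flip k).
Hypothesis X_sqr : forall k w, X k w * X k w = 1.
Hypothesis X_flip : forall k w, X k (flip k w) = - X k w.
Implicit Types (F G V Y : Om -> R) (k : I) (t z : R).

Definition Ex F : R := (\sum_w F w) / #|Om|%:R.

Lemma cardOm_gt0 : 0 < #|Om|%:R :> R.
Proof. by rewrite ltr0n; apply/card_gt0P; exists o0. Qed.

Lemma eq_Ex F G : F =1 G -> Ex F = Ex G.
Proof. by move=> FG; rewrite /Ex (eq_bigr G). Qed.

Lemma ExD F G : Ex (fun w => F w + G w) = Ex F + Ex G.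
Proof. by rewrite /Ex big_split/= mulrDl. Qed.

Lemma ExZ c F : Ex (fun w => c * F w) = c * Ex F.
Proof. by rewrite /Ex -mulr_sumr mulrA. Qed.

Lemma ExB F G : Ex (fun w => F w - G w) = Ex F - Ex G.
Proof. by rewrite /Ex sumrB mulrBl. Qed.

Lemma Ex_sum (J : finType) (F : J -> Om -> R) :
  Ex (fun w => \sum_j F j w) = \sum_j Ex (F j).
Proof. by rewrite /Ex exchange_big/= mulr_suml. Qed.

Lemma Ex_cst c : Ex (fun=> c) = c.
Proof.
by rewrite /Ex sumr_const -[c *+ _]mulr_natr mulfK// gt_eqF// cardOm_gt0.
Qed.

Lemma Ex_le F G : (forall w, F w <= G w) -> Ex F <= Ex G.
Proof.
by move=> FG; rewrite /Ex ler_pM2r ?invr_gt0 ?cardOm_gt0// ler_sum.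
Qed.

Lemma Ex_ge0 F : (forall w, 0 <= F w) -> 0 <= Ex F.
Proof. by move=> F0; rewrite -(Ex_cst 0); exact: Ex_le. Qed.

Lemma Ex_norm F : `|Ex F| <= Ex (fun w => `|F w|).
Proof.
by rewrite ler_norml -mulN1r -ExZ; apply/andP; split; apply: Ex_le => w;
  rewrite ?mulN1r ?ler_norm// lerNl -normrN ler_norm.
Qed.

Lemma Ex_flip k F : Ex (fun w => F (flip k w)) = Ex F.
Proof.
by rewrite /Ex [in RHS](reindex (flip k))//; apply: onW_bij; exact: inv_bij.
Qed.

(** The discrete gradient: half the difference between the values of [F] with the [k]-th sign set to
    [1] and to [-1], so it does not depend on that sign. *)
Definition flipD k F w : R := X k w * (F w - F (flip k w)) / 2.

Definition flip_inv k V := forall w, V (flip k w) = V w.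

Lemma X_norm k w : `|X k w| = 1.
Proof.
apply/eqP; rewrite -sqrp_eq1 ?normr_ge0//.
by rewrite -normrX expr2 X_sqr normr1.
Qed.

Lemma X_normM k w (r : R) : `|X k w * r| = `|r|.
Proof. by rewrite normrM X_norm mul1r. Qed.

Lemma flipE k F w : F (flip k w) = F w - 2 * X k w * flipD k F w.
Proof.
by rewrite /flipD; have := X_sqr k w; set x := X k w => xx; field : xx.
Qed.

(** The expectation is averaged with its image under the flip, which preserves the measure, fixes
    [V] and negates [X k]. *)
Lemma Ex_ibp k V F : flip_inv k V ->
  Ex (fun w => X k w * V w * F w) = Ex (fun w => V w * flipD k F w).
Proof.
move=> iV; have h : Ex (fun w => X k w * V w * F w)
    = Ex (fun w => - X k w * V w * F (flip k w)).
  by rewrite -(Ex_flip k); apply: eq_Ex => w; rewrite X_flip iV.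
have : 2 * Ex (fun w => V w * flipD k F w) =
    Ex (fun w => X k w * V w * F w) + Ex (fun w => - X k w * V w * F (flip k w)).
  by rewrite -ExD -ExZ; apply: eq_Ex => w; rewrite /flipD; lra.
by rewrite -h; lra.
Qed.

Lemma flipD_mul k F G w : flipD k (fun v => F v * G v) w =
  G w * flipD k F w + F w * flipD k G w - 2 * X k w * flipD k F w * flipD k G w.
Proof.
have := X_sqr k w; rewrite {1}/flipD !flipE; set x := X k w => xx.
by field : xx.
Qed.

Section W.
Variables (beta : I -> R) (V : I -> Om -> R) (eps B : R).
Hypothesis beta_ge0 : forall k, 0 <= beta k.
Hypothesis V_inv : forall k, flip_inv k (V k).

Definition sgn_sum (h : I -> Om -> R) w : R := \sum_k X k w * h k w.

(* Both error terms of Stein's method have the form [sgn_sum h] with [h] tame. *)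
Definition tame (h : I -> Om -> R) := forall k,
  [/\ flip_inv k (h k), forall w, `|h k w| <= beta k ^+ 2 &
     forall w, `|flipD k (sgn_sum h) w| <= beta k ^+ 2].

Local Notation W := (sgn_sum V).
Local Notation U k := (flipD k W).
Definition steinT w : R := \sum_k U k w * V k w.

Lemma Ex_sgn_sum (h : I -> Om -> R) F : (forall k, flip_inv k (h k)) ->
  Ex (fun w => sgn_sum h w * F w) = \sum_k Ex (fun w => h k w * flipD k F w).
Proof.
move=> hi; rewrite -(eq_bigr _ (fun k _ => Ex_ibp F (hi k))) -Ex_sum.
by apply: eq_Ex => w; rewrite /sgn_sum mulr_suml.
Qed.

Hypothesis V_le : forall k w, `|V k w| <= beta k.
Hypothesis U_le : forall k w, `|U k w| <= beta k.

Local Notation kappa := (expR (2 * B)).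
Local Notation e t := (fun w => expR (t * W w)).
Local Notation M t := (Ex (e t)).

Lemma flipD_expE k t w : flipD k (e t) w =
  X k w * e t w * ((1 - expR (- (2 * (t * (X k w * U k w))))) / 2).
Proof.
rewrite {1}/flipD flipE; set u := U k w; set x := X k w.
have -> : t * (W w - 2 * x * u) = t * W w + - (2 * (t * (x * u))) by lra.
by rewrite expRD; lra.
Qed.

Lemma flipD_exp_le k t w : 0 <= t -> t * beta k <= B ->
  `|flipD k (e t) w| <= kappa * (t * beta k) * e t w.
Proof.
move=> t0 tB; rewrite flipD_expE -mulrA X_normM normrM (gtr0_norm (expR_gt0 _)).
rewrite [leRHS]mulrC ler_wpM2l ?expR_ge0//.
have hx : `|t * (X k w * U k w)| <= t * beta k.
  by rewrite normrM X_normM ger0_norm// ler_wpM2l.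
apply: (le_trans (expR_sub1_le (le_trans hx tB))).
by rewrite ler_wpM2l ?expR_ge0.
Qed.

Lemma flipD_exp_taylor k t w : 0 <= t -> t * beta k <= B ->
  `|flipD k (e t) w - t * U k w * e t w| <= 2 * kappa * (t * beta k) ^+ 2 * e t w.
Proof.
move=> t0 tB.
have hx : `|t * (X k w * U k w)| <= t * beta k.
  by rewrite normrM X_normM ger0_norm// ler_wpM2l.
have -> : flipD k (e t) w - t * U k w * e t w = X k w * (e t w *
    ((1 - expR (- (2 * (t * (X k w * U k w))))) / 2 - t * (X k w * U k w))).
  rewrite flipD_expE /=; have := X_sqr k w; set x := X k w => xx.
  by ring : xx.
rewrite X_normM normrM (gtr0_norm (expR_gt0 _)).
rewrite [leRHS]mulrC ler_wpM2l ?expR_ge0//.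
apply: (le_trans (expR_sub1_taylor (le_trans hx tB))).
rewrite ler_wpM2l ?mulr_ge0 ?expR_ge0// -(real_normK (num_real (t * _))).
by rewrite ler_pXn2r// nnegrE ?normr_ge0// mulr_ge0.
Qed.

Hypothesis eps_gt0 : 0 < eps.
Hypothesis beta4 : \sum_k beta k ^+ 4 <= eps ^+ 2.
Hypothesis beta3 : \sum_k beta k ^+ 3 <= eps.
Hypothesis B_ge0 : 0 <= B.

Lemma kappa_ge1 : 1 <= kappa.
Proof. by rewrite -[leLHS]expR0 ler_expR mulr_ge0. Qed.

Lemma mgf_ge0 t : 0 <= M t.
Proof. by apply: Ex_ge0 => w; exact: expR_ge0. Qed.

Local Notation L3 := (\sum_k beta k ^+ 3).

Lemma L3_ge0 : 0 <= L3.
Proof. by apply: sumr_ge0 => k _; rewrite exprn_ge0. Qed.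

Lemma Ex_tame_exp (h : I -> Om -> R) t : tame h -> 0 <= t ->
  (forall k, t * beta k <= B) ->
  Ex (fun w => sgn_sum h w * e t w) <= kappa * t * L3 * M t.
Proof.
move=> gh t0 tB; rewrite Ex_sgn_sum => [|k]; last by have [] := gh k.
rewrite [kappa * t * _]mulr_sumr mulr_suml; apply: ler_sum => k _.
rewrite -ExZ; apply: Ex_le => w; have [_ hk _] := gh k.
apply: le_trans (ler_norm _) _; rewrite normrM.
apply: le_trans (ler_pM _ _ (hk w) (flipD_exp_le w t0 (tB k))) _ => //.
by rewrite le_eqVlt; apply/orP; left; apply/eqP; ring.
Qed.

Variable hT : I -> Om -> R.
Hypothesis tame_T : tame hT.
Hypothesis T_rep : forall w, steinT w = 1 + sgn_sum hT w.

(** This bounds the derivative of the moment generating function. The 3 is 2 from the Taylor error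
    of [D_k exp (t W)] plus 1 from [steinT - 1]. *)
Lemma Ex_W_exp t : 0 <= t -> (forall k, t * beta k <= B) ->
  Ex (fun w => W w * e t w) <= (t + 3 * kappa * t ^+ 2 * L3) * M t.
Proof.
move=> t0 tB; rewrite Ex_sgn_sum//.
apply: (@le_trans _ _ (t * Ex (fun w => steinT w * e t w) + 2 * kappa * t ^+ 2 * L3 * M t)).
  rewrite -ExZ [_ * L3]mulr_sumr mulr_suml.
  have -> : Ex (fun w => t * (steinT w * e t w)) = \sum_k Ex (fun w => V k w * (t * U k w * e t w)).
    rewrite -Ex_sum; apply: eq_Ex => w.
    by rewrite /steinT mulr_suml mulr_sumr; apply: eq_bigr => k _; ring.
  rewrite -big_split/=; apply: ler_sum => k _.
  rewrite -ExZ -ExD; apply: Ex_le => w.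
  rewrite -lerBlDl -mulrBr (le_trans (ler_norm _))// normrM.
  apply: le_trans (ler_pM _ _ (V_le k w) (flipD_exp_taylor w t0 (tB k))) _ => //.
  by rewrite le_eqVlt; apply/orP; left; apply/eqP; ring.
have -> : Ex (fun w => steinT w * e t w) = M t + Ex (fun w => sgn_sum hT w * e t w).
  by rewrite -ExD; apply: eq_Ex => w; rewrite T_rep; ring.
have := ler_wpM2l t0 (Ex_tame_exp tame_T t0 tB); lra.
Qed.

Lemma is_derive_mgf t : is_derive t 1 (fun s => M s) (Ex (fun w => W w * e t w)).
Proof.
have -> : (fun s => M s) = (fun s => #|Om|%:R^-1 * \sum_w e s w).
  by apply/funext => s; rewrite /Ex mulrC.
have -> : Ex (fun w => W w * e t w) = #|Om|%:R^-1 * \sum_w W w * e t w.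
  by rewrite /Ex mulrC.
have h : is_derive t 1 (fun s : R => \sum_w e s w) (\sum_w W w * e t w).
  apply: (@is_derive_bigsum _ _ _ (fun w s => e s w) (fun w s => W w * e s w)) => w.
  by apply: is_derive_eq; rewrite /GRing.scale/=; lra.
by apply: is_derive_eq; rewrite /GRing.scale/=; lra.
Qed.

(* Gronwall: by [Ex_W_exp], [M t * exp (- (t^2 / 2 + kappa L3 t^3))] decreases. *)
Lemma mgf_le t : 0 <= t -> (forall k, t * beta k <= B) -> t ^+ 3 * L3 <= B ->
  M t <= expR (kappa * B) * expR (t ^+ 2 / 2).
Proof.
move=> t0 tB t3.
pose q (s : R) : R := - (s ^+ 2 / 2 + kappa * L3 * s ^+ 3).
pose g (s : R) : R := M s * expR (q s).
pose dg (s : R) : R := (Ex (fun w => W w * e s w) -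
  (s + 3 * kappa * s ^+ 2 * L3) * M s) * expR (q s).
have gdg (s : R) : is_derive s 1 g (dg s).
  have h1 := is_derive_mgf s.
  have h2 : is_derive s 1 q (- (s + 3 * kappa * s ^+ 2 * L3)).
    by apply: is_derive_eq; rewrite /GRing.scale/=; lra.
  by apply: is_derive_eq; rewrite /GRing.scale/= /dg; lra.
have : g t <= g 0.
  apply: (@is_derive_nincr _ g dg _ _ t0) => s /andP[s0 st].
  rewrite /dg mulr_le0_ge0 ?expR_ge0// subr_le0 Ex_W_exp// => k.
  by rewrite (le_trans _ (tB k))// ler_wpM2r.
have -> : g 0 = 1.
  rewrite /g /q !expr0n/= mul0r mulr0 addr0 oppr0 expR0 mulr1.
  by rewrite -[RHS]Ex_cst; apply: eq_Ex => w; rewrite mul0r expR0.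
rewrite /g /q expRN ler_pdivrMr ?expR_gt0// mul1r expRD mulrC => h.
rewrite (le_trans h)// ler_wpM2r ?expR_ge0// ler_expR -mulrA ler_wpM2l ?expR_ge0//.
by rewrite mulrC.
Qed.

(** * Moments of the error terms under exponential weights *)

Section second_moment.
Variable h : I -> Om -> R.
Hypothesis tame_h : tame h.
Variable t : R.
Hypothesis t0 : 0 <= t.
Hypothesis tB : forall k, t * beta k <= B.
Local Notation Y := (sgn_sum h).

(** Integrating by parts against one factor [Y] leaves a multiple of [E(|Y| exp (t W))]; Young's
    inequality moves half of the second moment back to the left side. *)
Lemma Ex_sqr_exp : Ex (fun w => Y w ^+ 2 * e t w) <=
  (2 * (1 + 2 * kappa * B) + kappa ^+ 2) * (eps * (1 + t)) ^+ 2 * M t.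
Proof.
have k1 := kappa_ge1; have M0 := mgf_ge0 t; have L0 := L3_ge0.
pose P := Ex (fun w => `|Y w| * e t w).
have step1 : Ex (fun w => Y w ^+ 2 * e t w) <=
    (1 + 2 * kappa * B) * (\sum_k beta k ^+ 4) * M t + kappa * t * L3 * P.
  have -> : Ex (fun w => Y w ^+ 2 * e t w) =
      Ex (fun w => Y w * (Y w * e t w)).
    by apply: eq_Ex => w; rewrite mulrA expr2.
  rewrite Ex_sgn_sum => [|k]; last by have [] := tame_h k.
  rewrite [_ * \sum_k _ ^+ 4]mulr_sumr [_ * L3]mulr_sumr !mulr_suml -big_split/=.
  apply: ler_sum => k _; rewrite -!ExZ -ExD; apply: Ex_le => w.
  have [_ hk dk] := tame_h k.
  apply: le_trans (ler_norm _) _; rewrite normrM.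
  have b0 := beta_ge0 k; have e0 := expR_gt0 (t * W w).
  apply: (@le_trans _ _ (beta k ^+ 2 * (e t w * beta k ^+ 2 +
     `|Y w| * (kappa * (t * beta k) * e t w) +
     2 * beta k ^+ 2 * (kappa * B * e t w)))); last first.
    by rewrite le_eqVlt; apply/orP; left; apply/eqP; ring.
  apply: ler_pM => //.
  rewrite flipD_mul (le_trans (ler_normB _ _))// lerD//.
    rewrite (le_trans (ler_normD _ _))// lerD// normrM.
      by rewrite (gtr0_norm e0) ler_wpM2l ?dk// ltW.
    by rewrite ler_wpM2l ?flipD_exp_le.
  have -> : 2 * X k w * flipD k Y w * flipD k (e t) w = X k w * (2 * flipD k Y w * flipD k (e t) w).
    by ring.
  rewrite X_normM normrM normrM ger0_norm//; apply: ler_pM => //.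
    by rewrite ler_wpM2l ?dk.
  apply: le_trans (flipD_exp_le w t0 (tB k)) _.
  by rewrite ler_wpM2r ?expR_ge0// ler_wpM2l ?tB ?expR_ge0.
have step2 : kappa * t * L3 * P <=
    2^-1 * Ex (fun w => Y w ^+ 2 * e t w) + (kappa * t * L3) ^+ 2 / 2 * M t.
  rewrite /P -!ExZ -ExD; apply: Ex_le => w.
  have e0 := expR_gt0 (t * W w); have := sqr_ge0 (kappa * t * L3 - `|Y w|).
  rewrite -(real_normK (num_real (Y w))) => hs.
  have := mulr_ge0 hs (ltW e0); lra.
have h4 : (\sum_k beta k ^+ 4) * M t <= eps ^+ 2 * M t by rewrite ler_wpM2r.
have h3 : L3 ^+ 2 * M t <= eps ^+ 2 * M t.
  by rewrite ler_wpM2r// !expr2 ler_pM.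
have k0 : 0 <= kappa by lra.
have c0 : 0 <= 1 + 2 * kappa * B by rewrite addr_ge0// !mulr_ge0.
have := ler_wpM2l c0 h4.
have := ler_wpM2l (sqr_ge0 (kappa * t)) h3.
have E0 : 0 <= eps ^+ 2 * M t by rewrite mulr_ge0// sqr_ge0.
have t2 : 0 <= 1 + 2 * t by rewrite addr_ge0 ?mulr_ge0.
have t4 : 0 <= 2 * t + t ^+ 2 by rewrite addr_ge0 ?mulr_ge0 ?sqr_ge0.
have := mulr_ge0 (mulr_ge0 (sqr_ge0 kappa) t2) E0.
have := mulr_ge0 (mulr_ge0 c0 t4) E0.
lra.
Qed.

Definition sqr_const := 2 * (1 + 2 * kappa * B) + kappa ^+ 2.

Lemma sqr_const_ge1 : 1 <= sqr_const.
Proof.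
have := kappa_ge1; rewrite /sqr_const => k1.
have := mulr_ge0 (le_trans ler01 k1) B_ge0; have := sqr_ge0 kappa; lra.
Qed.

Lemma Ex_abs_exp : t ^+ 3 * L3 <= B -> Ex (fun w => `|Y w| * e t w) <=
  sqr_const * expR (kappa * B) * eps * (1 + t) * expR (t ^+ 2 / 2).
Proof.
move=> t3; have s0 : 0 < eps * (1 + t) by rewrite mulr_gt0// ltr_pwDl.
have := Ex_sqr_exp; rewrite -/sqr_const; set s := eps * (1 + t) in s0 * => h2.
have s2 : 0 < 2 * s by rewrite mulr_gt0.
(* [|Y| <= Y^2 / (2 s) + s / 2], with [s] of the order suggested by the second moment, in place of
   Cauchy-Schwarz. *)
have h1 : Ex (fun w => `|Y w| * e t w) <=
    (2 * s)^-1 * Ex (fun w => Y w ^+ 2 * e t w) + s / 2 * M t.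
  rewrite -!ExZ -ExD; apply: Ex_le => w; rewrite mulrA -mulrDl ler_wpM2r ?expR_ge0//.
  rewrite -(ler_pM2l s2) -(real_normK (num_real (Y w))); set y := `|Y w|.
  have -> : 2 * s * ((2 * s)^-1 * y ^+ 2 + s / 2) = y ^+ 2 + s ^+ 2.
    by field; rewrite gt_eqF.
  have := sqr_ge0 (y - s); lra.
have h3 : (2 * s)^-1 * Ex (fun w => Y w ^+ 2 * e t w) <= sqr_const * s / 2 * M t.
  rewrite ler_pdivrMl//; apply: le_trans h2 _.
  by rewrite le_eqVlt; apply/orP; left; apply/eqP; lra.
have k1 := sqr_const_ge1; have h4 := mgf_le t0 tB t3.
have h5 : sqr_const * s * M t <= sqr_const * s * (expR (kappa * B) * expR (t ^+ 2 / 2)).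
  by rewrite ler_wpM2l// mulr_ge0 ?ltW// (lt_le_trans ltr01).
have h6 : s * M t <= sqr_const * (s * M t).
  by rewrite ler_peMl// mulr_ge0 ?mgf_ge0 ?ltW.
rewrite -[_ * eps * _]mulrA -/s; lra.
Qed.
End second_moment.

(** * Tail probabilities relative to the Gaussian tail *)

Section tail.
Variable z : R.
Hypothesis z_ge : - 1 <= z.
Local Notation zp := (Num.max z 0).
Hypothesis zB : forall k, (1 + zp) * beta k <= B.
Hypothesis zL : (1 + zp) ^+ 3 * L3 <= B.

Definition abs_const := sqr_const * expR (kappa * B).

(** The three summands come from the three parts of [stein_dom]: the constant, the sum over [j], and
    the last exponential. *)
Definition dom_const := abs_const * (1 + 2 * iphi 1 + 2 * (iphi 1 + 1) * iphi 1).

Lemma abs_const_ge0 : 0 <= abs_const.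
Proof. by rewrite mulr_ge0 ?expR_ge0// (le_trans ler01) ?sqr_const_ge1. Qed.

(** At [t = j + 1] the moment bound [exp (t^2 / 2)] cancels the weight, leaving at most
    [2 (1 + zp)^2] for each of at most [1 + zp] indices. At [t = zp] the factor [exp (- zp^2 / 2)]
    survives and is bounded by the Gaussian tail. *)
Lemma Ex_stein_dom h : tame h -> Ex (fun w => `|sgn_sum h w| * stein_dom z (W w)) <=
  dom_const * eps * (1 + zp) ^+ 3 * (1 - Phi z).
Proof.
move=> gh; have zp0 : 0 <= zp by rewrite le_max lexx orbT.
have key t : 0 <= t -> t <= 1 + zp ->
    Ex (fun w => `|sgn_sum h w| * e t w) <= abs_const * eps * (1 + t) * expR (t ^+ 2 / 2).
  move=> t0 tz; apply: Ex_abs_exp => // [k|].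
    by rewrite (le_trans _ (zB k))// ler_wpM2r.
  by rewrite (le_trans _ zL)// ler_wpM2r ?L3_ge0// ler_pXn2r// nnegrE// addr_ge0.
pose N := (Num.truncn zp).+1.
have Nz : N%:R <= 1 + zp.
  by rewrite /N -natr1 addrC lerD2l; have /truncn_itv/andP[] := zp0.
have k3 := abs_const_ge0; have i0 := @iphi_gt0 R 1; have e0 := ltW eps_gt0.
have p0 : 0 <= 1 - Phi z by rewrite subr_ge0 Phi_le1.
pose s := \sum_(j < N) j.+1%:R * expR (- (j.+1%:R ^+ 2 / 2)) *
   Ex (fun w => `|sgn_sum h w| * e (j.+1%:R) w).
have -> : Ex (fun w => `|sgn_sum h w| * stein_dom z (W w)) =
    (1 - Phi z) * (Ex (fun w => `|sgn_sum h w| * e 0 w) + iphi 1 * s) +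
    (iphi 1 + 1) * expR (- zp ^+ 2) * Ex (fun w => `|sgn_sum h w| * e zp w).
  have -> : s = Ex (fun w => \sum_(j < N) j.+1%:R * expR (- (j.+1%:R ^+ 2 / 2)) *
      (`|sgn_sum h w| * e (j.+1%:R) w)).
    by rewrite Ex_sum; apply: eq_bigr => j _; rewrite ExZ.
  rewrite -!ExZ -ExD -!ExZ -ExD; apply: eq_Ex => w.
  rewrite /stein_dom -/N mul0r expR0.
  set S1 := \sum_(_ < _) _; set S2 := \sum_(_ < _) _.
  have -> : S2 = `|sgn_sum h w| * S1.
    by rewrite /S1 mulr_sumr; apply: eq_bigr => j _; ring.
  ring.
have h0 : Ex (fun w => `|sgn_sum h w| * e 0 w) <= abs_const * eps.
  have := key 0 (lexx 0); rewrite addr0 mulr1 expr0n/= mul0r expR0 mulr1.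
  by apply; rewrite addr_ge0.
have hs : s <= abs_const * eps * (2 * (1 + zp) ^+ 3).
  have zp1 : 0 <= 1 + zp by rewrite addr_ge0.
  apply: (@le_trans _ _ (\sum_(j < N) abs_const * eps * (2 * (1 + zp) ^+ 2))).
    apply: ler_sum => j _; have jN : j.+1%:R <= 1 + zp.
      by apply: le_trans Nz; rewrite ler_nat.
    have := key j.+1%:R (ler0n _ _) jN; set x := j.+1%:R in jN *.
    set E := Ex _ => hE; have x0 : 0 <= x by exact: ler0n.
    have hx : 0 <= x * expR (- (x ^+ 2 / 2)) by rewrite mulr_ge0 ?expR_ge0.
    apply: le_trans (ler_wpM2l hx hE) _.
    have -> : x * expR (- (x ^+ 2 / 2)) * (abs_const * eps * (1 + x) * expR (x ^+ 2 / 2)) =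
        abs_const * eps * (x * (1 + x)).
      rewrite expRN; field; exact: lt0r_neq0 (expR_gt0 _).
    apply: (ler_wpM2l (mulr_ge0 k3 e0)).
    rewrite expr2 mulrCA; apply: ler_pM => //; first by rewrite addr_ge0.
    by rewrite mulr_natl mulr2n lerD// lerDl.
  rewrite sumr_const card_ord -[_ *+ N]mulr_natr -mulrA; apply: (ler_wpM2l (mulr_ge0 k3 e0)).
  have := ler_wpM2l (sqr_ge0 (1 + zp)) Nz; lra.
have hz : expR (- zp ^+ 2) * Ex (fun w => `|sgn_sum h w| * e zp w) <=
    abs_const * eps * (1 + zp) * (2 * iphi 1 * (1 + zp) * (1 - Phi z)).
  apply: (@le_trans _ _ (abs_const * eps * (1 + zp) * expR (- (zp ^+ 2 / 2)))); last first.
    apply: (ler_wpM2l (mulr_ge0 (mulr_ge0 k3 e0) (addr_ge0 ler01 zp0))).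
    exact: gauss_tail_lower_max.
  have -> : expR (- (zp ^+ 2 / 2)) = expR (- zp ^+ 2) * expR (zp ^+ 2 / 2).
    by rewrite -expRD; congr expR; lra.
  rewrite [leRHS]mulrCA ler_wpM2l ?expR_ge0//; apply: key => //.
  by rewrite lerDr.
have c1 := mulr_ge0 (mulr_ge0 k3 e0) p0.
have z3 : 1 <= (1 + zp) ^+ 3 by rewrite exprn_ege1// lerDl.
have z2 : (1 + zp) ^+ 2 <= (1 + zp) ^+ 3 by rewrite ler_weXn2l// lerDl.
have := ler_wpM2l p0 h0; have := ler_wpM2l p0 (ler_wpM2l (ltW i0) hs).
have i1 : (0 : R) <= iphi 1 + 1 by rewrite addr_ge0// ltW.
have := ler_wpM2l i1 hz; have := ler_wpM2l c1 z3.
have := ler_wpM2l (mulr_ge0 (mulr_ge0 c1 i1) (ltW i0)) z2.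
rewrite /dom_const; lra.
Qed.

Hypothesis tame_S : tame (fun k w => `|V k w| * U k w).

(** Bounding the expansion error term by term replaces [V k] by its absolute value, hence [tame_S].
    The 5 is 1 for [steinT - 1] plus 4 for the expansion error, a factor 2 from [e2] and another
    from [psi2]. *)
Lemma stein_tail :
  `|Ex (fun w => (z < W w)%R%:R) - (1 - Phi z)| <=
    5 * dom_const * eps * (1 + zp) ^+ 3 * (1 - Phi z).
Proof.
pose f w := steinf z (W w); pose f' w := dsteinf z (W w); pose psi w := steinpsi z (W w).
pose S := sgn_sum (fun k w => `|V k w| * U k w).
have e1 : Ex f' - Ex (fun w => W w * f w) =
    (1 - Phi z) - Ex (fun w => (z < W w)%R%:R).
  rewrite -ExB -[1 - Phi z]Ex_cst -ExB; apply: eq_Ex => w.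
  by rewrite /f' /f /dsteinf /steing leNgt; case: (z < W w) => /=; lra.
have e2 : `|Ex (fun w => W w * f w) - Ex (fun w => steinT w * f' w)| <=
    2 * Ex (fun w => S w * psi w).
  rewrite Ex_sgn_sum// [in X in _ <= X]Ex_sgn_sum; last first.
    by move=> k; have [] := tame_S k.
  have -> : Ex (fun w => steinT w * f' w) = \sum_k Ex (fun w => V k w * (U k w * f' w)).
    rewrite -Ex_sum; apply: eq_Ex => w; rewrite /steinT mulr_suml.
    by apply: eq_bigr => k _; ring.
  rewrite -sumrB mulr_sumr (le_trans (ler_norm_sum _ _ _))//.
  apply: ler_sum => k _; rewrite -ExB -ExZ (le_trans (Ex_norm _))//.
  apply: Ex_le => w; rewrite -mulrBr normrM.
  have -> : 2 * (`|V k w| * U k w * flipD k psi w) = `|V k w| * (2 * U k w * flipD k psi w).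
    by ring.
  rewrite ler_wpM2l//.
  have hr := stein_remainder z (W w) (W (flip k w)).
  have -> : flipD k f w - U k w * f' w = X k w * ((f w - f (flip k w)
      - (W w - W (flip k w)) * f' w) / 2).
    by rewrite /flipD; ring.
  rewrite X_normM normrM (@ger0_norm _ 2^-1)//.
  have -> : 2 * U k w * flipD k psi w =
      (W w - W (flip k w)) * (psi w - psi (flip k w)) / 2.
    by rewrite /flipD; have := X_sqr k w; set x := X k w => xx; field : xx.
  by rewrite ler_wpM2r.
have psi2 w : `|psi w| <= 2 * stein_dom z (W w).
  have [_ h2 h3] := stein_domP (W w) z_ge.
  rewrite /psi /steinpsi (le_trans (ler_normD _ _))// (@ger0_norm _ (_ < _)%R%:R)//; lra.
have hS : Ex (fun w => S w * psi w) <= 2 * Ex (fun w => `|S w| * stein_dom z (W w)).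
  rewrite -ExZ; apply: Ex_le => w; apply: le_trans (ler_norm _) _.
  by rewrite normrM mulrCA ler_wpM2l.
have hT' : `|Ex f' - Ex (fun w => steinT w * f' w)| <=
    Ex (fun w => `|sgn_sum hT w| * stein_dom z (W w)).
  rewrite -ExB (le_trans (Ex_norm _))//; apply: Ex_le => w.
  have [h1 _ _] := stein_domP (W w) z_ge.
  have -> : f' w - steinT w * f' w = - (sgn_sum hT w * f' w) by rewrite T_rep; ring.
  by rewrite normrN normrM ler_wpM2l.
have k1 := Ex_stein_dom tame_T; have k2 := Ex_stein_dom tame_S.
rewrite -/S in k2.
rewrite distrC -e1.
have -> : Ex f' - Ex (fun w => W w * f w) = (Ex f' - Ex (fun w => steinT w * f' w)) -
    (Ex (fun w => W w * f w) - Ex (fun w => steinT w * f' w)) by ring.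
apply: le_trans (ler_normB _ _) _; lra.
Qed.
End tail.
End W.
End Flip.

(** * Two-runs on a cycle *)

Lemma cauchy_schwarz_sum {R : realDomainType} (J : Type) (r : seq J) (x y : J -> R) :
  (\sum_(j <- r) x j * y j) ^+ 2 <=
    (\sum_(j <- r) x j ^+ 2) * (\sum_(j <- r) y j ^+ 2).
Proof.
elim: r => [|j r IH]; first by rewrite !big_nil expr0n mul0r.
rewrite !big_cons; set a := \sum_(_ <- _) _ in IH *.
set b := \sum_(_ <- _) _ in IH *; set c := \sum_(_ <- _) _ in IH *.
have b0 : 0 <= b by rewrite sumr_ge0// => i _; exact: sqr_ge0.
have c0 : 0 <= c by rewrite sumr_ge0// => i _; exact: sqr_ge0.
suff : 2 * (x j * y j) * a <= x j ^+ 2 * c + y j ^+ 2 * b by lra.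
set u := 2 * _ * _; set v := _ + _.
have v0 : 0 <= v by rewrite addr_ge0// mulr_ge0 ?sqr_ge0.
rewrite (le_trans (ler_norm u))// -(@ler_pXn2r _ 2)// ?nnegrE//.
rewrite (real_normK (num_real u)).
have := ler_wpM2l (sqr_ge0 (x j * y j)) IH.
have := sqr_ge0 (x j ^+ 2 * c - y j ^+ 2 * b); rewrite /u /v; lra.
Qed.

Lemma sum_expr2_le {R : realDomainType} (J : Type) (r : seq J) (x : J -> R) :
  (\sum_(j <- r) x j) ^+ 2 <= (size r)%:R * \sum_(j <- r) x j ^+ 2.
Proof.
have ones : \sum_(j <- r) (1 : R) ^+ 2 = (size r)%:R.
  by rewrite big_const_seq count_predT iter_addr_0 expr1n.
have := cauchy_schwarz_sum r (fun=> 1) x; rewrite ones.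
by under eq_bigr do rewrite mul1r.
Qed.

Lemma sum_expr4_le {R : realDomainType} (J : Type) (r : seq J) (x : J -> R) :
  (\sum_(j <- r) x j) ^+ 4 <= (size r)%:R ^+ 3 * \sum_(j <- r) x j ^+ 4.
Proof.
have h1 := sum_expr2_le r x; have h2 := sum_expr2_le r (fun j => x j ^+ 2).
have h3 : ((\sum_(j <- r) x j) ^+ 2) ^+ 2 <=
    ((size r)%:R * \sum_(j <- r) x j ^+ 2) ^+ 2.
  rewrite ler_pXn2r// nnegrE ?sqr_ge0// mulr_ge0// sumr_ge0// => j _.
  exact: sqr_ge0.
rewrite -exprM in h3; apply: (le_trans h3).
rewrite exprMn [_ ^+ 3]exprSr -mulrA ler_wpM2l ?sqr_ge0//.
by under [in X in _ <= _ * X]eq_bigr do rewrite (exprM _ 2 2).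
Qed.

Section Runs.
Context {R : realType} (n : nat).
(** Indices are added modulo [n + 3], so every shift is a bijection of the summation range; three
    sites suffice to keep [k], [k + 1] and [k + 1 + 1] distinct. *)
Local Notation I := 'I_n.+3.
Local Notation Om := {ffun I -> bool}.

Definition bflip (k : I) (w : Om) : Om := [ffun j => if j == k then ~~ w j else w j].
Definition bsgn (k : I) (w : Om) : R := if w k then 1 else -1.

Lemma bflipK k : involutive (bflip k).
Proof. by move=> w; apply/ffunP => j; rewrite !ffunE; case: eqP; rewrite ?negbK. Qed.

Lemma bsgn_sqr k w : bsgn k w * bsgn k w = 1.
Proof. by rewrite /bsgn; case: (w k); rewrite ?mul1r ?mulN1r ?opprK. Qed.

Lemma bsgn_flip k w : bsgn k (bflip k w) = - bsgn k w.
Proof. by rewrite /bsgn ffunE eqxx; case: (w k); rewrite ?opprK. Qed.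

Lemma bsgn_flip_neq j k w : j != k -> bsgn j (bflip k w) = bsgn j w.
Proof. by rewrite /bsgn ffunE => /negPf->. Qed.

(* [sgn_sum bsgn runV] is the centred sum
   [\sum_k d k * (x k + x (k + 1) + x k * x (k + 1))] over the cycle. *)
Variable d : I -> R.
Let c k := d k + d (k - 1).

Definition runV k w : R := c k + d k * bsgn (k + 1) w.
Local Notation V := runV.
Local Notation W := (sgn_sum bsgn runV).
Local Notation D := (flipD bflip bsgn).

(** The [k]-th summand is linear in the [k]-th sign; in the other summands only the coefficient
    [h j] can see the flip. *)
Lemma flipD_sgn_sum (h : I -> Om -> R) k w : (forall v, h k (bflip k v) = h k v) ->
  D k (sgn_sum bsgn h) w = h k w + \sum_(j | j != k) bsgn j w * D k (h j) w.
Proof.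
move=> hk; rewrite {1}/flipD /sgn_sum !(bigD1 (P := xpredT) k)//= bsgn_flip hk.
set S1 := \sum_(_ | _) _; set S2 := \sum_(_ | _) _; set S3 := \sum_(_ | _) _.
have -> : S3 = bsgn k w * (S1 - S2) / 2.
  rewrite /S1 /S2 -sumrB mulr_sumr mulr_suml; apply: eq_bigr => j jk.
  by rewrite /flipD bsgn_flip_neq//; lra.
have := bsgn_sqr k w; set x := bsgn k w => xx; by field : xx.
Qed.

Lemma addr1_neq (k : I) : k + 1 != k.
Proof. by rewrite -subr_eq0 addrAC subrr add0r. Qed.

Lemma addr2_neq (k : I) : k + 1 + 1 != k.
Proof. by rewrite -[X in _ != X]addr0 -addrA (inj_eq (addrI k)). Qed.

Lemma runV_flip j k w : j + 1 != k -> V j (bflip k w) = V j w.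
Proof. by move=> jk; rewrite /V bsgn_flip_neq. Qed.

Lemma runV_inv k : flip_inv bflip k (V k).
Proof. by move=> w; rewrite runV_flip// addr1_neq. Qed.

Lemma flipD_runV k w : D k W w = V k w + d (k - 1) * bsgn (k - 1) w.
Proof.
rewrite flipD_sgn_sum; last exact: runV_inv.
congr (_ + _); rewrite (bigD1 (k - 1))/=; last by rewrite -[X in _ != X](subrK 1) eq_sym addr1_neq.
rewrite big1 ?addr0 => [|j /andP[_ jk]]; last first.
  by rewrite /flipD runV_flip ?subrr ?mulr0 ?mul0r ?mulr0// eq_sym -(subr_eq k j 1) eq_sym.
rewrite /flipD /V subrK bsgn_flip; have := bsgn_sqr k w; set x := bsgn k w => xx.
by field : xx.
Qed.

(** The coefficient of the [k]-th sign in [steinT] minus its mean, once all terms are shifted to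
    [k]. The product of the signs at [k] and [k + 1 + 1] is attached to the earlier one. *)
Definition runT k w : R :=
  2 * c (k - 1) * d (k - 1) + d k * c (k + 1) + d k * d (k + 1) * bsgn (k + 1 + 1) w.

Lemma sum_shift (F : I -> R) (s : I) : \sum_k F (k + s) = \sum_k F k.
Proof.
rewrite [RHS](reindex (fun k => k + s))//; apply: onW_bij.
by exists (fun k => k - s) => k; rewrite ?addrK ?subrK.
Qed.

Definition run_var : R := \sum_k ((d k + d (k - 1)) ^+ 2 + d k ^+ 2).

Lemma runT_rep w : steinT bflip bsgn V w = run_var + sgn_sum bsgn runT w.
Proof.
pose x k := bsgn k w.
transitivity (\sum_k ((c k ^+ 2 + d k ^+ 2) + 2 * c k * d k * x (k + 1) +
   d (k - 1) * c k * x (k - 1) + d (k - 1) * d k * x (k - 1) * x (k + 1))).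
  apply: eq_bigr => k _; rewrite flipD_runV /V -/(x _) -/(x (k - 1)).
  have := bsgn_sqr (k + 1) w; rewrite -/(x _); set y := x (k + 1) => yy.
  by ring : yy.
rewrite big_split big_split big_split/= -!addrA; congr (_ + _).
rewrite -(sum_shift (fun k => 2 * c k * d k * x (k + 1)) (-1)).
rewrite -(sum_shift (fun k => d (k - 1) * c k * x (k - 1)) 1).
rewrite -(sum_shift (fun k => d (k - 1) * d k * x (k - 1) * x (k + 1)) 1).
rewrite -!big_split/=; apply: eq_bigr => k _.
by rewrite subrK addrK /runT -/(x _) -/(x (k + 1 + 1)); ring.
Qed.

(* Flipping the sign at [k] only affects the terms of the two errors at
   [k - 2, ..., k + 1], which involve [d] at offsets from [k] in [window]. *)
Definition window : seq I :=
  [:: 0; 1; 1 + 1; 1 + 1 + 1; - 1; - 1 - 1; - 1 - 1 - 1; - 1 - 1 - 1 - 1].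
Definition window_sum k : R := \sum_(s <- window) `|d (k + s)|.

Lemma window_sum_ge k s : s \in window -> `|d (k + s)| <= window_sum k.
Proof.
move=> sw; rewrite /window_sum (big_rem s)//= lerDl.
by apply: sumr_ge0.
Qed.

Lemma window_sum_ge0 k : 0 <= window_sum k.
Proof. by apply: sumr_ge0. Qed.

Lemma window_sum_bounds k :
  [/\ `|d (k + 1 + 1 + 1)| <= window_sum k, `|d (k + 1 + 1)| <= window_sum k,
      `|d (k + 1)| <= window_sum k &
      `|d k| <= window_sum k] /\
  [/\ `|d (k - 1)| <= window_sum k, `|d (k - 1 - 1)| <= window_sum k,
      `|d (k - 1 - 1 - 1)| <= window_sum k & `|d (k - 1 - 1 - 1 - 1)| <= window_sum k].
Proof.
have h s t : s \in window -> k + s = t -> `|d t| <= window_sum k.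
  by move=> /(window_sum_ge k) + <-.
split; split.
- by apply: (h (1 + 1 + 1)); rewrite ?addrA// !inE eqxx ?orbT.
- by apply: (h (1 + 1)); rewrite ?addrA// !inE eqxx ?orbT.
- by apply: (h 1); rewrite // !inE eqxx ?orbT.
- by apply: (h 0); rewrite ?addr0// !inE eqxx ?orbT.
- by apply: (h (- 1)); rewrite // !inE eqxx ?orbT.
- by apply: (h (- 1 - 1)); rewrite ?addrA// !inE eqxx ?orbT.
- by apply: (h (- 1 - 1 - 1)); rewrite ?addrA// !inE eqxx ?orbT.
- by apply: (h (- 1 - 1 - 1 - 1)); rewrite ?addrA// !inE eqxx ?orbT.
Qed.

Lemma bsgn_norm k w : `|bsgn k w| = 1.
Proof. by rewrite /bsgn; case: (w k); rewrite ?normrN normr1. Qed.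

Lemma runV_norm k w : `|V k w| <= 2 * `|d k| + `|d (k - 1)|.
Proof.
rewrite /V (le_trans (ler_normD _ _))// normrM bsgn_norm mulr1.
have := ler_normD (d k) (d (k - 1)); rewrite -/(c k); lra.
Qed.

Lemma flipD_run_norm k w : `|D k W w| <= 2 * `|d k| + 2 * `|d (k - 1)|.
Proof.
rewrite flipD_runV (le_trans (ler_normD _ _))// normrM bsgn_norm mulr1.
have := runV_norm k w; lra.
Qed.

Lemma runT_norm k w : `|runT k w| <= 2 * (`|d (k - 1)| + `|d (k - 1 - 1)|) * `|d (k - 1)| +
   `|d k| * (`|d (k + 1)| + `|d k|) + `|d k| * `|d (k + 1)|.
Proof.
rewrite /runT (le_trans (ler_normD _ _))// lerD//; last first.
  by rewrite !normrM bsgn_norm mulr1.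
rewrite (le_trans (ler_normD _ _))// lerD//.
  by rewrite !normrM (@ger0_norm _ 2)// ler_wpM2r// ler_wpM2l// /c ler_normD.
rewrite normrM ler_wpM2l// /c addrK; exact: ler_normD.
Qed.

(** [7 ^+ 2] exceeds [4 * 12]: in [local_tame] a flip is felt by the summand at [k] and by three
    others, each costing [12 * window_sum k ^+ 2]. *)
Definition runbeta k : R := 7 * window_sum k.

Lemma flipD_norm_le (F : Om -> R) (b : R) k w : (forall v, `|F v| <= b) -> `|D k F w| <= b.
Proof.
move=> Fb; rewrite /flipD -mulrA normrM bsgn_norm mul1r normrM (@ger0_norm _ 2^-1)//.
have := ler_normB (F w) (F (bflip k w)); have := Fb w; have := Fb (bflip k w); lra.
Qed.

Lemma flipD_flip_inv (F : Om -> R) k w : (forall v, F (bflip k v) = F v) -> D k F w = 0.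
Proof. by move=> Fi; rewrite /flipD Fi subrr mulr0 mul0r. Qed.

Lemma local_tame (h : I -> Om -> R) :
  (forall j k, j != k -> j + 1 != k -> j + 1 + 1 != k -> j - 1 != k ->
    flip_inv bflip k (h j)) ->
  (forall k, flip_inv bflip k (h k)) ->
  (forall k w, `|h k w| <= 12 * window_sum k ^+ 2 /\ `|h (k - 1) w| <= 12 * window_sum k ^+ 2 /\
    `|h (k - 1 - 1) w| <= 12 * window_sum k ^+ 2 /\ `|h (k + 1) w| <= 12 * window_sum k ^+ 2) ->
  tame bflip bsgn runbeta h.
Proof.
move=> hloc hinv hb k; have N0 := window_sum_ge0 k.
have N2 := sqr_ge0 (window_sum k).
split=> [//|w|w]; first by have [+ _] := hb k w; rewrite /runbeta; lra.
rewrite (flipD_sgn_sum _ (hinv k)) (le_trans (ler_normD _ _))//.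
pose S := [:: k - 1; k - 1 - 1; k + 1].
have : `|\sum_(j | j != k) bsgn j w * D k (h j) w| <=
    \sum_(j <- S) 12 * window_sum k ^+ 2.
  rewrite (le_trans (ler_norm_sum _ _ _))//.
  apply: (@le_trans _ _ (\sum_(j | j \in S) `|D k (h j) w|)).
    rewrite [leRHS](bigID (fun j => j != k))/= ler_wpDr ?sumr_ge0//.
    rewrite [leLHS](bigID (fun j => j \in S))/=.
    rewrite [X in _ + X]big1 ?addr0 => [|j /andP[jk jS]]; last first.
      rewrite flipD_flip_inv ?mulr0 ?normr0//; apply: hloc => //.
      - by apply: contra jS => /eqP kE; rewrite !inE -kE addrK eqxx.
      - by apply: contra jS => /eqP kE; rewrite !inE -kE !addrK eqxx orbT.
      - by apply: contra jS => /eqP kE; rewrite !inE -kE subrK eqxx !orbT.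
    rewrite le_eqVlt; apply/orP; left; apply/eqP.
    apply: eq_big => [j|j _]; first by rewrite andbC.
    by rewrite normrM bsgn_norm mul1r.
  (* On a cycle of three sites [k - 1 - 1] and [k + 1] coincide, so duplicates are removed before
     passing from the set to the list. *)
  apply: (@le_trans _ _ (\sum_(j <- undup S) `|D k (h j) w|)).
    rewrite (big_uniq _ (undup_uniq S)) le_eqVlt; apply/orP; left; apply/eqP.
    by apply: eq_bigl => j; rewrite mem_undup.
  apply: (@le_trans _ _ (\sum_(j <- undup S) 12 * window_sum k ^+ 2)).
    rewrite big_seq [leRHS]big_seq; apply: ler_sum => j; rewrite mem_undup => jS.
    apply: flipD_norm_le => v; have [_ [h1 [h2 h3]]] := hb k v.
    by move: jS; rewrite !inE => /or3P[] /eqP ->.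
  rewrite !big_const_seq !count_predT !iter_addr_0.
  rewrite -[_ *+ size (undup S)]mulr_natr -[_ *+ size S]mulr_natr.
  by apply: ler_wpM2l; rewrite ?mulr_ge0// ler_nat size_undup.
rewrite !big_cons big_nil.
have [+ _] := hb k w; rewrite /runbeta; lra.
Qed.

Lemma flipD_runV_flip j k w : j - 1 != k -> j + 1 != k ->
  D j W (bflip k w) = D j W w.
Proof. by move=> h1 h2; rewrite !flipD_runV runV_flip// bsgn_flip_neq. Qed.

Lemma subr1_neq (k : I) : k - 1 != k.
Proof. by rewrite -[X in _ != X](subrK 1) eq_sym addr1_neq. Qed.

Lemma tame_runT : tame bflip bsgn runbeta runT.
Proof.
apply: local_tame => [j k jk j1 j2 jm w|k w|k w].
- by rewrite /runT bsgn_flip_neq.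
- by rewrite /runT bsgn_flip_neq// addr2_neq.
have [[? ? h1 h0] [m1 m2 m3 m4]] := window_sum_bounds k.
have N0 := window_sum_ge0 k.
have key x y u v : `|x| <= window_sum k -> `|y| <= window_sum k ->
    `|u| <= window_sum k -> `|v| <= window_sum k ->
    2 * (`|x| + `|y|) * `|x| + `|u| * (`|v| + `|u|) + `|u| * `|v| <= 12 * window_sum k ^+ 2.
  have := normr_ge0 x; have := normr_ge0 y; have := normr_ge0 u; have := normr_ge0 v.
  set x' := `|x|; set y' := `|y|; set u' := `|u|; set v' := `|v| => *; nra.
by do !split; apply: (le_trans (runT_norm _ _)); rewrite ?addrK ?subrK; apply: key.
Qed.

Lemma tame_runS : tame bflip bsgn runbeta (fun k w => `|V k w| * D k W w).
Proof.
apply: local_tame => [j k jk j1 j2 jm w|k w|k w].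
- by rewrite runV_flip// flipD_runV_flip.
- by rewrite runV_flip ?addr1_neq// flipD_runV_flip ?addr1_neq ?subr1_neq.
have [[? ? h1 h0] [m1 m2 m3 m4]] := window_sum_bounds k.
have N0 := window_sum_ge0 k.
have key j : `|d j| <= window_sum k -> `|d (j - 1)| <= window_sum k ->
    `| `|V j w| * D j W w| <= 12 * window_sum k ^+ 2.
  move=> hj hj1; rewrite normrM normr_id.
  have v1 := runV_norm j w; have v2 := flipD_run_norm j w.
  (* This product is the origin of the 12 in [local_tame]. *)
  apply: (@le_trans _ _ ((3 * window_sum k) * (4 * window_sum k))); last by nra.
  by apply: ler_pM => //; lra.
by do !split; apply: key; rewrite ?addrK.
Qed.

Lemma Ex_sgn_sum_eq0 (h : I -> Om -> R) : (forall k, flip_inv bflip k (h k)) ->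
  Ex (sgn_sum bsgn h) = 0.
Proof.
move=> hi; have := Ex_sgn_sum (@bflipK) bsgn_flip (fun=> 1) hi.
rewrite (eq_Ex (G := sgn_sum bsgn h)) => [->|w]; last by rewrite mulr1.
rewrite big1// => k _; rewrite -[RHS](Ex_cst ([ffun=> true] : Om)).
by apply: eq_Ex => w; rewrite /flipD subrr mulr0 mul0r mulr0.
Qed.

Lemma Ex_run : Ex W = 0.
Proof. by apply: Ex_sgn_sum_eq0; exact: runV_inv. Qed.

(** Integration by parts with [F = W] turns the second moment into the mean of [steinT]. *)
Lemma Ex_run_sqr : Ex (fun w => W w ^+ 2) = run_var.
Proof.
transitivity (Ex (fun w => W w * W w)); first by apply: eq_Ex => w; rewrite expr2.
rewrite (Ex_sgn_sum (@bflipK) bsgn_flip _ runV_inv) -Ex_sum.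
transitivity (Ex (fun w => run_var + sgn_sum bsgn runT w)).
  by apply: eq_Ex => w; rewrite -runT_rep; apply: eq_bigr => k _; rewrite mulrC.
rewrite ExD (Ex_cst ([ffun=> true] : Om)) Ex_sgn_sum_eq0 ?addr0// => k.
by have [] := tame_runT k.
Qed.

Hypothesis d_norm : run_var = 1.

Let Q4 := \sum_k d k ^+ 4.

Lemma sum_window_sum (p : nat) : \sum_k \sum_(s <- window) `|d (k + s)| ^+ p =
  8 * \sum_k `|d k| ^+ p.
Proof.
rewrite exchange_big/= (eq_bigr (fun=> \sum_k `|d k| ^+ p)) => [|s _]; last first.
  by rewrite (sum_shift (fun k => `|d k| ^+ p)).
by rewrite big_const_seq count_predT iter_addr_0 mulr_natl.
Qed.

(** 56 is the factor 7 of [runbeta] times the 8 shifts in [window]. *)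
Lemma runbeta4 : \sum_k runbeta k ^+ 4 <= 56 ^+ 4 * Q4.
Proof.
apply: (@le_trans _ _ (\sum_k (7 ^+ 4 * 8 ^+ 3 * \sum_(s <- window) `|d (k + s)| ^+ 4))).
  apply: ler_sum => k _; rewrite /runbeta exprMn -mulrA ler_wpM2l ?exprn_ge0//.
  exact: (sum_expr4_le window).
rewrite -mulr_sumr sum_window_sum; rewrite (eq_bigr (fun k => d k ^+ 4)) => [|k _]; last first.
  by rewrite -[4%N]/(2 * 2)%N !exprM real_normK ?num_real.
rewrite -/Q4; lra.
Qed.

Lemma runbeta2 : \sum_k runbeta k ^+ 2 <= 56 ^+ 2.
Proof.
have Q2 : \sum_k d k ^+ 2 <= 1.
  by rewrite -d_norm /run_var; apply: ler_sum => k _; rewrite lerDr sqr_ge0.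
apply: (@le_trans _ _ (\sum_k (7 ^+ 2 * 8 * \sum_(s <- window) `|d (k + s)| ^+ 2))).
  apply: ler_sum => k _; rewrite /runbeta exprMn -mulrA ler_wpM2l ?exprn_ge0//.
  exact: (sum_expr2_le window).
rewrite -mulr_sumr sum_window_sum; rewrite (eq_bigr (fun k => d k ^+ 2)) => [|k _]; last first.
  by rewrite real_normK ?num_real.
lra.
Qed.

Lemma Q4_gt0 : 0 < Q4.
Proof.
rewrite lt_neqAle sumr_ge0 ?andbT => [|k _]; last by rewrite (exprM _ 2 2) sqr_ge0.
apply/eqP => /esym/eqP; rewrite psumr_eq0 => [/allP h|k _]; last first.
  by rewrite (exprM _ 2 2) sqr_ge0.
have d0 k : d k = 0.
  by have := h k (mem_index_enum _); rewrite /= expf_eq0/= => /eqP.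
move: d_norm; rewrite /run_var big1 => [/eqP|k _]; last by rewrite !d0 addr0 expr0n addr0.
by rewrite eq_sym oner_eq0.
Qed.

(** Cauchy-Schwarz between [runbeta] and its square; the unit variance enters through [runbeta2]. *)
Lemma runbeta3 : \sum_k runbeta k ^+ 3 <= 56 ^+ 3 * Num.sqrt Q4.
Proof.
have b0 k : 0 <= runbeta k by rewrite mulr_ge0 ?window_sum_ge0.
have h := cauchy_schwarz_sum (index_enum I) runbeta (fun k => runbeta k ^+ 2).
have Q0 := ltW Q4_gt0; have s0 := sqrtr_ge0 Q4.
rewrite -(@ler_pXn2r _ 2)// ?nnegrE ?mulr_ge0 ?exprn_ge0//; last first.
  by apply: sumr_ge0 => k _; rewrite exprn_ge0.
rewrite exprMn sqr_sqrtr//.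
rewrite (eq_bigr (fun k => runbeta k * runbeta k ^+ 2)); last by move=> k _; rewrite exprS.
apply: (le_trans h).
rewrite (_ : (56 ^+ 3) ^+ 2 * Q4 = 56 ^+ 2 * (56 ^+ 4 * Q4)); last by ring.
apply: ler_pM; [by apply: sumr_ge0 => k _; exact: sqr_ge0|
  by apply: sumr_ge0 => k _; exact: sqr_ge0|exact: runbeta2|].
rewrite (eq_bigr (fun k => runbeta k ^+ 4)); first exact: runbeta4.
by move=> k _; rewrite -exprM.
Qed.

Lemma runs_tail (z B : R) : - 1 <= z -> 1 <= B ->
  (1 + Num.max z 0) ^+ 3 * Num.sqrt Q4 <= B ->
  `|Ex (fun w => (z < W w)%R%:R) - (1 - Phi z)| <=
    5 * dom_const (56 ^+ 3 * B) * (56 ^+ 3 * Num.sqrt Q4) *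
      (1 + Num.max z 0) ^+ 3 * (1 - Phi z).
Proof.
move=> z1 B1 hB; set zp := Num.max z 0 in hB *.
have zp0 : 0 <= zp by rewrite le_max lexx orbT.
have Q0 := ltW Q4_gt0; have s0 := sqrtr_ge0 Q4.
have s1 : 0 < Num.sqrt Q4 by rewrite sqrtr_gt0 Q4_gt0.
have N0 := window_sum_ge0.
have b0 k : 0 <= runbeta k by rewrite mulr_ge0.
apply: (@stein_tail _ _ _ [ffun=> true] bflip bsgn bflipK bsgn_sqr bsgn_flip runbeta V
  _ _ b0 runV_inv _ _ _ _ _ _ runT tame_runT) => //.
- move=> k w; have [[_ _ _ h0] [h1 _ _ _]] := window_sum_bounds k.
  by have := runV_norm k w; have := N0 k; rewrite /runbeta; lra.
- move=> k w; have [[_ _ _ h0] [h1 _ _ _]] := window_sum_bounds k.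
  by have := flipD_run_norm k w; have := N0 k; rewrite /runbeta; lra.
- by rewrite mulr_gt0.
- rewrite exprMn sqr_sqrtr// (le_trans runbeta4)// ler_wpM2r//; lra.
- exact: runbeta3.
- by rewrite mulr_ge0//; lra.
- by move=> w; rewrite runT_rep d_norm.
(* A single [runbeta k ^+ 2] is at most the root of the sum of fourth powers, so the pointwise
   condition follows from [hB] after squaring. *)
- move=> k; rewrite -(@ler_pXn2r _ 2)// ?nnegrE ?mulr_ge0 ?addr_ge0//; last by lra.
  have bk : runbeta k ^+ 2 <= 56 ^+ 2 * Num.sqrt Q4.
    rewrite -(@ler_pXn2r _ 2)// ?nnegrE ?sqr_ge0 ?mulr_ge0//.
    rewrite [X in _ <= X]exprMn sqr_sqrtr// -!exprM.
    apply: le_trans runbeta4; rewrite (bigD1 k)//= lerDl.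
    by apply: sumr_ge0 => j _; rewrite exprn_ge0.
  rewrite exprMn.
  have z2 : (1 + zp) ^+ 2 <= (1 + zp) ^+ 3 by rewrite ler_weXn2l// lerDl.
  have h1 := ler_wpM2l (sqr_ge0 (1 + zp)) bk.
  have h2 := ler_wpM2r s0 z2.
  have : B <= B ^+ 2 by rewrite expr2 ler_peMr// (le_trans ler01).
  have : 0 <= (1 + zp) ^+ 2 * Num.sqrt Q4 by rewrite mulr_ge0// sqr_ge0.
  rewrite -/zp; lra.
- have := ler_wpM2l (exprn_ge0 3 (addr_ge0 ler01 zp0)) runbeta3; rewrite -/zp; lra.
- exact: tame_runS.
Qed.

End Runs.

(** * Rescaling to unit variance *)

Section ScaledRuns.
Context {R : realType} (n : nat).
Local Notation I := 'I_n.+3.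
Variable d : I -> R.
Hypothesis v0 : 0 < run_var d.
Local Notation W := (sgn_sum (@bsgn R n) (runV d)).
Local Notation eps := (Num.sqrt (\sum_k d k ^+ 4) / run_var d).

Definition run_const : R := 5 * dom_const (56 ^+ 3) * 56 ^+ 3.

Lemma scaled_runs_tail z : - 1 <= z -> (1 + Num.max z 0) ^+ 3 * eps <= 1 ->
  `|Ex (fun w => (z * Num.sqrt (run_var d) < W w)%R%:R) - (1 - Phi z)| <=
    run_const * eps * (1 + Num.max z 0) ^+ 3 * (1 - Phi z).
Proof.
move=> z1 hz; pose s := Num.sqrt (run_var d); pose d' k := d k / s.
have s0 : 0 < s by rewrite sqrtr_gt0.
have s2 : s ^+ 2 = run_var d by rewrite sqr_sqrtr// ltW.
have n1 : run_var d' = 1.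
  transitivity (run_var d / s ^+ 2); last by rewrite s2 divff// gt_eqF.
  rewrite /run_var mulr_suml; apply: eq_bigr => k _.
  by rewrite /d'; field; rewrite gt_eqF.
have e' : Num.sqrt (\sum_k d' k ^+ 4) = eps.
  have -> : \sum_k d' k ^+ 4 = (\sum_k d k ^+ 4) / (run_var d) ^+ 2.
    rewrite -s2 mulr_suml; apply: eq_bigr => k _.
    by rewrite /d'; field; rewrite gt_eqF.
  rewrite sqrtrM ?sumr_ge0// => [|k _]; last by rewrite (exprM _ 2 2) sqr_ge0.
  by rewrite sqrtrV ?sqr_ge0// sqrtr_sqr gtr0_norm.
have := runs_tail n1 z1 (lexx 1); rewrite e' mulr1 => /(_ hz).
rewrite (eq_Ex (G := fun w => (z * s < W w)%R%:R)) => [h|w].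
  by rewrite /run_const -[_ * 56 ^+ 3 * eps]mulrA.
congr (_%:R); congr nat_of_bool; rewrite -ltr_pdivlMr//; congr (_ < _).
rewrite /sgn_sum mulr_suml; apply: eq_bigr => k _.
by rewrite /runV /d'; field; rewrite gt_eqF.
Qed.
End ScaledRuns.

(** * Expectations of almost surely bounded functions *)

Section AlmostSure.
Context {R : realType} {d} {T : measurableType d} (P : probability T R).
Variable G : set T.
Hypothesis mG : measurable G.
Hypothesis PG : P (~` G) = 0%E.
Implicit Types f g : T -> R.

(** Integrating over a set of full measure lets estimates that hold only where all signs are [1] or
    [-1] be used pointwise. *)
Definition EE f : R := \int[P]_(w in G) f w.

Definition ess_bounded f :=
  measurable_fun [set: T] f /\ exists C, forall w, G w -> `|f w| <= C.

Lemma ess_bounded_cst (c : R) : ess_bounded (fun=> c).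
Proof. by split; [exact: measurable_cst|exists `|c|]. Qed.

Lemma ess_boundedD f g : ess_bounded f -> ess_bounded g ->
  ess_bounded (fun w => f w + g w).
Proof.
move=> [mf [C Cf]] [mg [D Dg]]; split; first exact: measurable_funD.
exists (C + D) => w Gw; apply: le_trans (ler_normD _ _) _.
by rewrite lerD ?Cf ?Dg.
Qed.

Lemma ess_boundedM f g : ess_bounded f -> ess_bounded g ->
  ess_bounded (fun w => f w * g w).
Proof.
move=> [mf [C Cf]] [mg [D Dg]]; split; first exact: measurable_funM.
by exists (C * D) => w Gw; rewrite normrM ler_pM ?Cf ?Dg.
Qed.

Lemma ess_boundedZ (c : R) f : ess_bounded f -> ess_bounded (fun w => c * f w).
Proof. by move=> bf; apply: ess_boundedM bf; exact: ess_bounded_cst. Qed.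

Lemma ess_boundedB f g : ess_bounded f -> ess_bounded g ->
  ess_bounded (fun w => f w - g w).
Proof.
move=> bf /(ess_boundedZ (-1)) bg; have := ess_boundedD bf bg.
by under eq_fun do rewrite mulN1r.
Qed.

Lemma ess_bounded_sum (J : Type) (r : seq J) (F : J -> T -> R) :
  (forall j, ess_bounded (F j)) -> ess_bounded (fun w => \sum_(j <- r) F j w).
Proof.
move=> bF; elim: r => [|j r IH].
  by under eq_fun do rewrite big_nil; exact: ess_bounded_cst.
by under eq_fun do rewrite big_cons; exact: ess_boundedD.
Qed.

Lemma ess_bounded_indic (A : set T) : measurable A -> ess_bounded \1_A.
Proof.
move=> mA; split; first exact: measurable_indic.
by exists 1 => w _; rewrite indicE; case: (_ \in _); rewrite ?normr1 ?normr0.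
Qed.

Lemma PG1 : P G = 1%E.
Proof.
by rewrite -[G]setCK probability_setC ?PG ?sube0//; exact: measurableC.
Qed.

Lemma ess_bounded_integrable f : ess_bounded f -> P.-integrable G (EFin \o f).
Proof.
move=> [mf [C Cf]]; apply: measurable_bounded_integrable => //.
- exact: le_lt_trans (probability_le1 P mG) (ltry _).
- exact: measurable_funTS.
- exists C; split; first exact: num_real.
  by move=> x Cx w Gw; exact: le_trans (Cf _ Gw) (ltW Cx).
Qed.

Lemma expectation_EE f : ess_bounded f -> 'E_P[f]%E = (EE f)%:E.
Proof.
move=> bf; have If := ess_bounded_integrable bf.
rewrite unlock /EE /Rintegral fineK; last exact: integrable_fin_num.
have mGC : measurable (~` G) by exact: measurableC.
have eG : setT `\` ~` G = G by rewrite setTD setCK.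
have mf : measurable_fun [set: T] (EFin \o f).
  by apply/measurable_EFinP; have [] := bf.
rewrite -[in RHS]eG; apply: negligible_integral => //.
by apply/(negligible_integrable mGC measurableT mf PG); rewrite eG.
Qed.

Lemma eq_EE f g : (forall w, G w -> f w = g w) -> EE f = EE g.
Proof. by move=> fg; apply: eq_Rintegral => w; rewrite inE => /fg. Qed.

Lemma EED f g : ess_bounded f -> ess_bounded g ->
  EE (fun w => f w + g w) = EE f + EE g.
Proof. by move=> bf bg; apply: RintegralD => //; exact: ess_bounded_integrable. Qed.

Lemma EEB f g : ess_bounded f -> ess_bounded g ->
  EE (fun w => f w - g w) = EE f - EE g.
Proof. by move=> bf bg; apply: RintegralB => //; exact: ess_bounded_integrable. Qed.

Lemma EEZ (c : R) f : ess_bounded f -> EE (fun w => c * f w) = c * EE f.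
Proof. by move=> bf; apply: RintegralZl => //; exact: ess_bounded_integrable. Qed.

Lemma EE_cst (c : R) : EE (fun=> c) = c.
Proof.
rewrite /EE (@Rintegral_cst _ _ _ P G mG c).
by rewrite -[RHS]mulr1; congr (_ * _); exact: (congr1 fine PG1). Qed.

Lemma EE_sum (J : Type) (r : seq J) (F : J -> T -> R) :
  (forall j, ess_bounded (F j)) ->
  EE (fun w => \sum_(j <- r) F j w) = \sum_(j <- r) EE (F j).
Proof.
move=> bF; elim: r => [|j r IH].
  by under eq_fun do rewrite big_nil; rewrite EE_cst big_nil.
under eq_fun do rewrite big_cons.
by rewrite big_cons EED ?IH//; exact: ess_bounded_sum.
Qed.

Lemma EE_le f g : ess_bounded f -> ess_bounded g ->
  (forall w, G w -> f w <= g w) -> EE f <= EE g.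
Proof. by move=> bf bg fg; apply: le_Rintegral => //; exact: ess_bounded_integrable. Qed.

Lemma EE_dist f g (r : R) : ess_bounded f -> ess_bounded g ->
  (forall w, G w -> `|f w - g w| <= r) -> `|EE f - EE g| <= r.
Proof.
move=> bf bg fg; have bfg := ess_boundedB bf bg.
rewrite -EEB// ler_norml; apply/andP; split.
  rewrite -(EE_cst (- r)); apply: EE_le => //; first exact: ess_bounded_cst.
  by move=> w /fg; rewrite ler_norml => /andP[].
rewrite -[leRHS](EE_cst r); apply: EE_le => //; first exact: ess_bounded_cst.
by move=> w /fg; rewrite ler_norml => /andP[].
Qed.

Lemma EE_indic (A : set T) : measurable A -> EE \1_A = fine (P A).
Proof.
move=> mA; have := expectation_EE (ess_bounded_indic mA).
by rewrite expectation_indic// => ->.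
Qed.

End AlmostSure.

(** * Sums over the integers *)

Section ZSum.
Context {R : realType}.
Implicit Types a b : int -> R.

Definition zpart b (N : nat) : R := \sum_(i < N.*2.+1) b (i%:Z - N%:Z).

Lemma zpartS b N : zpart b N.+1 = zpart b N + b N.+1%:Z + b (- N.+1%:Z).
Proof.
rewrite /zpart doubleS big_ord_recl big_ord_recr/=.
rewrite [LHS]addrC; congr (_ + _ + _).
- by apply: eq_bigr => i _; congr (b _); rewrite /bump /=; lia.
- by congr (b _); rewrite /bump; lia.
- by congr (b _); lia.
Qed.

Lemma zpartD b1 b2 N : zpart (fun i => b1 i + b2 i) N = zpart b1 N + zpart b2 N.
Proof. by rewrite /zpart big_split. Qed.

Lemma zpart_ndecr b : (forall i, 0 <= b i) -> nondecreasing_seq (zpart b).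
Proof.
move=> b0; apply/nondecreasing_seqP => N.
by rewrite zpartS -addrA lerDl addr_ge0.
Qed.

Lemma zpart_le b1 b2 N : (forall i, b1 i <= b2 i) -> zpart b1 N <= zpart b2 N.
Proof. by move=> b12; apply: ler_sum. Qed.

Section dominated.
Variable a : int -> R.
Hypothesis a_ge0 : forall i, 0 <= a i.
Variable A : R.
Hypothesis a_bound : forall N, zpart a N <= A.

Lemma cvg_zpart_ge0 : zpart a @ \oo --> zsum a.
Proof.
apply: nondecreasing_is_cvgn; first exact: zpart_ndecr.
by exists A => _ [N _ <-].
Qed.

Lemma zpart_le_zsum N : zpart a N <= zsum a.
Proof.
apply: (cvgr_to_ge cvg_zpart_ge0); near=> M.
by apply: zpart_ndecr => //; near: M; exact: nbhs_infty_ge.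
Unshelve. all: end_near. Qed.

Variable b : int -> R.
Hypothesis ba : forall i, `|b i| <= a i.

Lemma zpart_dist N M : (N <= M)%N -> `|zpart b M - zpart b N| <= zpart a M - zpart a N.
Proof.
elim: M => [|M IH]; first by rewrite leqn0 => /eqP ->; rewrite !subrr normr0.
rewrite leq_eqVlt => /predU1P[->|/IH h]; first by rewrite !subrr normr0.
rewrite !zpartS; have := ba M.+1%:Z; have := ba (- M.+1%:Z).
move: h; rewrite !ler_norml => /andP[? ?] /andP[? ?] /andP[? ?].
by apply/andP; split; lra.
Qed.

(** [a + b] is nonnegative with partial sums at most [2 * A], so it converges monotonically; [a] is
    then subtracted. *)
Lemma cvg_zpart : zpart b @ \oo --> zsum b.
Proof.
suff : cvgn (zpart b) by [].
have h : cvgn (zpart (fun i => a i + b i)).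
  apply: nondecreasing_is_cvgn.
    by apply: zpart_ndecr => i; have := ba i; rewrite ler_norml => /andP[? ?]; lra.
  exists (2 * A) => _ [N _ <-]; apply: (@le_trans _ _ (2 * zpart a N)).
    rewrite /zpart mulr_sumr; apply: ler_sum => i _.
    by have := ba (i%:Z - N%:Z); rewrite ler_norml => /andP[? ?]; lra.
  by rewrite ler_wpM2l.
have -> : zpart b = (fun N => zpart (fun i => a i + b i) N - zpart a N).
  by apply/funext => N; rewrite zpartD addrC addKr.
by apply: is_cvgB => //; apply: cvgP cvg_zpart_ge0.
Qed.

(** The bound depends on the majorant [a] alone, which makes the truncation error uniform over
    outcomes. *)
Lemma zsum_dist N : `|zsum b - zpart b N| <= zsum a - zpart a N.
Proof.
have h : (fun M => `|zpart b M - zpart b N|) @ \oo --> `|zsum b - zpart b N|.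
  by apply: cvg_norm; apply: cvgB; [exact: cvg_zpart|exact: cvg_cst].
apply: (cvgr_to_le h); near=> M.
have NM : (N <= M)%N by near: M; exact: nbhs_infty_ge.
by apply: le_trans (zpart_dist NM) _; rewrite lerD2r zpart_le_zsum.
Unshelve. all: end_near. Qed.

Lemma zsum_norm_le : `|zsum b| <= zsum a.
Proof.
have h : (fun M => `|zpart b M|) @ \oo --> `|zsum b|.
  by apply: cvg_norm; exact: cvg_zpart.
apply: (cvgr_to_le h); near=> M.
apply: le_trans (ler_norm_sum _ _ _) _; apply: le_trans (zpart_le_zsum M).
by apply: ler_sum.
Unshelve. all: end_near. Qed.

End dominated.

(** A symmetric partial sum runs over a finite subset of the index set of the unordered sum. *)
Lemma summable_zpart a : summable [set: int] (fun i => (a i)%:E) ->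
  forall N, zpart (fun i => `|a i|) N <= fine (\esum_(i in [set: int]) `|(a i)%:E|)%E.
Proof.
move=> sa N; rewrite -lee_fin fineK -?summableE//.
pose r := [seq (nat_of_ord i)%:Z - N%:Z | i <- index_enum 'I_(N.*2.+1)].
have ur : uniq r.
  rewrite map_inj_uniq ?index_enum_uniq// => i j /(congr1 (fun x => x + N%:Z)).
  by rewrite !subrK => -[] /val_inj.
apply: esum_ge; exists [set` r]; first by split => //; exact: finite_seq.
rewrite -fsbig_seq// /r big_map /zpart sumEFin lee_fin.
by [].
Qed.

End ZSum.

(** * Measurability of pointwise limits *)

Section MeasurableLimit.
Context {R : realType} {d} {T : measurableType d}.
Variable h : nat -> T -> R.
Hypothesis mh : forall n, measurable_fun [set: T] (h n).

(** The Cauchy criterion expresses convergence through countable unions and intersections. *)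
Lemma measurable_cvgn_set : measurable [set w | cvgn (h^~ w)].
Proof.
have -> : [set w | cvgn (h^~ w)] = \bigcap_k \bigcup_N \bigcap_m
    [set w | `|h (N + m) w - h N w| <= k.+1%:R^-1].
  apply/seteqP; split => w /=.
    move=> cw k _; have k0 : 0 < k.+1%:R^-1 / 2 :> R by rewrite divr_gt0 ?invr_gt0.
    have /cvgrPdist_le/(_ _ k0) [N _ hN] := cw; exists N => // m _ /=.
    apply: le_trans (ler_distD (limn (h^~ w)) _ _) _.
    by rewrite [leRHS]splitr distrC; apply: lerD; apply: hN => //=; exact: leq_addr.
  move=> hw; apply: cauchy_cvg; apply: cauchy_exP => e e0.
  have [k ke] : exists k : nat, k.+1%:R^-1 < e.
    exists (Num.truncn e^-1); rewrite invf_plt ?posrE//.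
    by have /truncn_itv/andP[] : 0 <= e^-1 by rewrite invr_ge0 ltW.
  have [N _ hN] := hw k I; exists (h N w); exists N => // n /= Nn.
  rewrite -ball_normE /ball_/= distrC.
  have := hN (n - N)%N I; rewrite /= subnKC// => /le_lt_trans; exact.
apply: bigcap_measurable => // k _; apply: bigcup_measurable => // N _.
apply: bigcap_measurable => // m _.
have -> : [set w | `|h (N + m)%N w - h N w| <= k.+1%:R^-1] =
    (fun w => `|h (N + m)%N w - h N w|) @^-1` `]-oo, k.+1%:R^-1].
  by apply/seteqP; split => w /=; rewrite in_itv.
rewrite -[X in measurable X]setTI.
have mf : measurable_fun [set: T] (fun w => `|h (N + m)%N w - h N w|).
  apply: measurableT_comp => //; exact: measurable_funB.
exact: mf.
Qed.

(* [limn] returns the default point where the sequence diverges *)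
Lemma measurable_limn : measurable_fun [set: T] (fun w => limn (h^~ w)).
Proof.
have mA := measurable_cvgn_set; set A := [set w | cvgn (h^~ w)] in mA.
apply: (@measurable_fun_cvg _ _ _ _
  (fun n w => h n w * \1_A w + (point : R) * (1 - \1_A w))).
  move=> n; apply: measurable_funD.
    by apply: measurable_funM => //; exact: measurable_indic.
  apply: measurable_funM => //; apply: measurable_funB => //; exact: measurable_indic.
move=> w _; rewrite indicE; have [wA|wA] := pselect (A w).
  rewrite mem_set//; under eq_fun do rewrite mulr1 subrr mulr0 addr0.
  exact: wA.
rewrite memNset//; under eq_fun do rewrite mulr0 add0r subr0 mulr1.
have -> : limn (h^~ w) = point by apply: dvgP.
exact: cvg_cst.
Qed.
End MeasurableLimit.

(** * Finite blocks of the sign sequence *)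

Section Bits.
Context {R : realType} {d} {T : measurableType d} (P : probability T R).
Variable X : int -> {RV P >-> R}.
Hypothesis iidX : iid_rademacher X.

Let pm1 (i : int) : set T := X i @^-1` [set 1] `|` X i @^-1` [set -1].

Let msgn (i : int) (c : R) : measurable (X i @^-1` [set c]).
Proof. by rewrite -[X in measurable X]setTI; exact: measurable_funP. Qed.

Let Ppm1 i : P (~` pm1 i) = 0%E.
Proof.
have [h1 [h2 _]] := iidX.
have mp : measurable (pm1 i) by apply: measurableU.
have P1 : P (pm1 i) = 1%E.
  rewrite /pm1 measureU//.
    by rewrite [X in (X + _)%E]h1 [X in (_ + X)%E]h2 -EFinD; congr EFin; lra.
  rewrite -subset0 => w [/= -> ] /eqP; rewrite -subr_eq0 opprK.
  by rewrite (_ : 1 + 1 = 2%:R :> R)// pnatr_eq0.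
by rewrite probability_setC// P1 subee.
Qed.

(** The variables take the values [1] and [-1] only almost surely. Pairing [n] with [- n] reaches
    every integer by an intersection over the naturals. *)
Definition sign_event : set T := \bigcap_(n : nat) (pm1 n%:Z `&` pm1 (- n%:Z)).

Lemma measurable_sign_event : measurable sign_event.
Proof.
by apply: bigcap_measurable => // n _; apply: measurableI; apply: measurableU.
Qed.

Lemma sign_eventP w i : sign_event w -> X i w = 1 \/ X i w = -1.
Proof.
move=> Gw; have [n [->|->]] : exists n : nat, i = n%:Z \/ i = - n%:Z.
- by exists `|i|%N; lia.
- by have [] := Gw n I.
- by have [] := Gw n I.
Qed.

Lemma P_sign_event : P (~` sign_event) = 0%E.
Proof.
apply/(@negligibleP _ _ _ P); first by apply: measurableC; exact: measurable_sign_event.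
rewrite setC_bigcap; apply: negligible_bigcup => n.
have np i : P.-negligible (~` pm1 i).
  by apply/negligibleP; [apply: measurableC; apply: measurableU|exact: Ppm1].
by rewrite setCI; apply: negligibleU.
Qed.

Section block.
Variable M : nat.
(** The terms of index [- N] to [N] involve the signs at [- N] to [N + 1], that is [2 * N + 2]
    sites; [N >= 1] gives this number the form [n.+3]. *)
Local Notation N := M.+1.
Local Notation I := 'I_(M.*2.+1).+3.
Local Notation Om := {ffun I -> bool}.

Definition site (k : I) : int := k%:Z - N%:Z.
Definition pattern (w : T) : Om := [ffun k => X (site k) w == 1].

Lemma site_inj : injective site.
Proof.
by move=> k l /(congr1 (fun x => x + N%:Z)); rewrite /site !subrK => -[] /val_inj.
Qed.

(** Independence is stated for sets indexed by all integers, so the pattern is read through [inord],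
    which inverts [site] on the block. *)
Let pev (s : Om) : set T := \big[setI/setT]_(i <- map site (enum I))
  X i @^-1` [set if s (inord (absz (i + N%:Z))) then 1 else -1].

Let mpev s : measurable (pev s).
Proof.
rewrite /pev; elim: (map _ _) => [|i r IH]; first by rewrite big_nil.
by rewrite big_cons; apply: measurableI.
Qed.

Let Ppev s : fine (P (pev s)) = #|Om|%:R^-1.
Proof.
have [h1 [h2 h3]] := iidX.
rewrite /pev h3; last 2 first.
- by rewrite map_inj_uniq ?enum_uniq//; exact: site_inj.
- by move=> i; exact: measurable_set1.
rewrite (eq_bigr (fun=> 2^-1)) => [|i _]; last first.
  by case: (s _); rewrite ?h1 ?h2.
rewrite big_const_seq count_predT size_map size_enum_ord iter_mulr_1.
by rewrite card_ffun card_bool card_ord natrX exprVn.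
Qed.

Let pevE s w : sign_event w -> \1_(pev s) w = (s == pattern w)%:R :> R.
Proof.
move=> Gw; rewrite indicE; congr (_%:R); congr nat_of_bool.
have key k : (X (site k) w = if s (inord (absz (site k + N%:Z))) then 1 else -1) <->
    s k = pattern w k.
  have -> : inord (absz (site k + N%:Z)) = k.
    by rewrite /site subrK/= inord_val.
  rewrite ffunE; have n11 : (-1 == 1 :> R) = false.
    by rewrite eq_sym -subr_eq0 opprK (_ : 1 + 1 = 2%:R :> R)// pnatr_eq0.
  case: (sign_eventP (site k) Gw) => ->; rewrite ?eqxx ?n11; case: (s k); split => //.
    by move=> /eqP; rewrite eq_sym n11.
  by move=> /eqP; rewrite n11.
apply/idP/eqP.
  rewrite inE /pev => h; apply/ffunP => k; apply/key.
  move: h; rewrite -bigcap_seq => /(_ (site k)); apply.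
  by rewrite /= map_f// mem_enum.
move=> sp; rewrite inE /pev -bigcap_seq => i /= /mapP[k _ ->].
by apply/key; rewrite sp.
Qed.

(** A combination of indicators, measurable and bounded on the whole space by construction; it
    agrees with [h (pattern w)] on the sign event. *)
Definition on_pattern (h : Om -> R) (w : T) : R := \sum_s h s * \1_(pev s) w.

Lemma on_patternE h w : sign_event w -> on_pattern h w = h (pattern w).
Proof.
move=> Gw; rewrite /on_pattern (bigD1 (pattern w))//= pevE// eqxx mulr1.
rewrite big1 ?addr0// => s /negPf sp; by rewrite pevE// sp mulr0.
Qed.

Lemma ess_bounded_on_pattern h : ess_bounded sign_event (on_pattern h).
Proof.
apply: ess_bounded_sum => s; apply: ess_boundedZ; exact: ess_bounded_indic.
Qed.

Lemma EE_on_pattern h : EE P sign_event (on_pattern h) = Ex h.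
Proof.
have mG := measurable_sign_event; have PG := P_sign_event.
rewrite /on_pattern EE_sum//; last first.
  by move=> s; apply: ess_boundedZ; exact: ess_bounded_indic.
rewrite /Ex mulr_suml; apply: eq_bigr => s _.
rewrite EEZ//; last exact: ess_bounded_indic.
by rewrite EE_indic// Ppev.
Qed.

Variable a : int -> R.

(* [xi_i xi_(i+1) - 1/4 = (X_i + X_(i+1) + X_i X_(i+1)) / 4]; the coefficient
   at the last site is zero, so closing the block into a cycle is harmless. *)
Definition block_coef (k : I) : R := if (k < N.*2.+1)%N then a (site k) / 4 else 0.

Lemma block_sum w : sign_event w ->
  zpart (fun i => a i * xi X i w * xi X (i + 1) w) N =
  zpart a N / 4 + sgn_sum (@bsgn R _) (runV block_coef) (pattern w).
Proof.
move=> Gw; pose x k : R := bsgn k (pattern w).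
have xE k : x k = X (site k) w.
  rewrite /x /bsgn ffunE; case: (sign_eventP (site k) Gw) => ->; rewrite ?eqxx//.
  by rewrite eq_sym -subr_eq0 opprK (_ : 1 + 1 = 2%:R :> R)// pnatr_eq0.
have -> : sgn_sum (@bsgn R _) (runV block_coef) (pattern w) =
    \sum_k block_coef k * (x k + x (k + 1) + x k * x (k + 1)).
  transitivity (\sum_k (x k * (block_coef k + block_coef k * x (k + 1)) +
      x k * block_coef (k - 1))).
    by apply: eq_bigr => k _; rewrite /runV -/(x _) -/(x (k + 1)); ring.
  rewrite big_split/= -(sum_shift (fun k => x k * block_coef (k - 1)) 1) -big_split/=.
  by apply: eq_bigr => k _; rewrite addrK; ring.
rewrite big_ord_recr/= [block_coef ord_max]/block_coef ltnn mul0r addr0.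
rewrite /zpart mulr_suml -big_split/=; apply: eq_bigr => i _.
pose k : I := widen_ord (leqnSn _) i.
have k1 : nat_of_ord (k + 1 : I) = i.+1.
  by rewrite /= modn_small// ?addn1// ltnS; have := ltn_ord i.
have s0 : site k = i%:Z - N%:Z by [].
have s1 : site (k + 1) = i%:Z - N%:Z + 1 by rewrite /site k1; lia.
have bk : block_coef k = a (i%:Z - N%:Z) / 4 by rewrite /block_coef/= (ltn_ord i).
rewrite -[widen_ord _ i]/k bk !xE s0 s1 /xi; by field.
Qed.

End block.
End Bits.

(** * Passage to the bi-infinite sum *)

Section Transfer.
Context {R : realType} {d} {T : measurableType d} (P : probability T R).
Variable X : int -> {RV P >-> R}.
Hypothesis iidX : iid_rademacher X.
Variable a : int -> R.
Hypothesis sum_a : summable [set: int] (fun i => (a i)%:E).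

Local Notation GG := (sign_event X).
Local Notation EE := (EE P GG).
Let mGG : measurable GG := measurable_sign_event X.
Let PGG : P (~` GG) = 0%E := P_sign_event iidX.

Let absa (i : int) : R := `|a i|.
Let absa_ge0 i : 0 <= absa i. Proof. exact: normr_ge0. Qed.
Let absa_bound := summable_zpart sum_a.
Local Notation l1 := (zsum absa).
Local Notation r N := (l1 - zpart absa N).

Let r_ge0 N : 0 <= r N.
Proof. by rewrite subr_ge0 (zpart_le_zsum absa_ge0 absa_bound). Qed.

Let cvg_r : (fun N => r N) @ \oo --> (0 : R).
Proof.
rewrite -(subrr l1); apply: cvgB; first exact: cvg_cst.
exact: (cvg_zpart_ge0 absa_ge0 absa_bound).
Qed.

Let absa_le i : absa i <= l1.
Proof.
apply: le_trans (zpart_le_zsum absa_ge0 absa_bound (absz i)).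
have iN : (absz (i + (absz i)%:Z)%R < (absz i).*2.+1)%N by lia.
rewrite /zpart (bigD1 (Ordinal iN))//= (_ : _ - _ = i); last by lia.
by rewrite lerDl sumr_ge0.
Qed.

Let term w i := a i * xi X i w * xi X (i + 1) w.

Let term_le w i : GG w -> `|term w i| <= absa i.
Proof.
move=> Gw; have x01 j : 0 <= xi X j w <= 1.
  by rewrite /xi; case: (sign_eventP j Gw) => ->; apply/andP; split; lra.
have /andP[x0 x1] := x01 i; have /andP[y0 y1] := x01 (i + 1).
rewrite /term -mulrA normrM (ger0_norm (mulr_ge0 x0 y0)).
by apply: ler_piMr => //; exact: mulr_ile1.
Qed.

Let mG : measurable_fun [set: T] (Gsum X a).
Proof.
apply: (@measurable_limn _ _ _ (fun N w => zpart (term w) N)) => N.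
apply: measurable_sum => i.
have mx j : measurable_fun [set: T] (xi X j).
  by apply: measurable_funM => //; apply: measurable_funD => //.
by apply: measurable_funM => //; apply: measurable_funM.
Qed.

Let G_dist w N : GG w -> `|Gsum X a w - zpart (term w) N| <= r N.
Proof. by move=> Gw; apply: (zsum_dist absa_ge0 absa_bound) => i; exact: term_le. Qed.

Let G_le w : GG w -> `|Gsum X a w| <= l1.
Proof. by move=> Gw; apply: (zsum_norm_le absa_ge0 absa_bound) => i; exact: term_le. Qed.

Let bG : ess_bounded GG (Gsum X a).
Proof. by split => //; exists l1 => w; exact: G_le. Qed.

Let EGE : EG X a = EE (Gsum X a).
Proof. by rewrite /EG (expectation_EE mGG PGG bG). Qed.

Let VarGE : VarG X a = EE (fun w => (Gsum X a w - EG X a) ^+ 2).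
Proof.
have b1 : ess_bounded GG (fun w => Gsum X a w - EG X a).
  by apply: ess_boundedB => //; exact: ess_bounded_cst.
rewrite /VarG /variance covariance.unlock -/(EG X a).
rewrite (expectation_EE mGG PGG (ess_boundedM b1 b1))/=.
by apply: eq_EE => w _; rewrite expr2.
Qed.

Let EE_norm_le f (C : R) : ess_bounded GG f -> (forall w, GG w -> `|f w| <= C) -> `|EE f| <= C.
Proof.
move=> bf fC; rewrite -[EE f]subr0 -(EE_cst mGG PGG 0).
apply: (EE_dist mGG PGG) => //; first exact: ess_bounded_cst.
by move=> w Gw; rewrite subr0 fC.
Qed.

Section block.
Variable M : nat.
Local Notation N := M.+1.
Local Notation dM := (block_coef (M := M) a).
Local Notation W := (sgn_sum (@bsgn R _) (runV dM)).
Local Notation v := (run_var dM).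

Let GN := on_pattern X (fun s => zpart a N / 4 + W s).

Let GNE w : GG w -> GN w = zpart (term w) N.
Proof. by move=> Gw; rewrite /GN on_patternE// -block_sum. Qed.

Let bGN : ess_bounded GG GN. Proof. exact: ess_bounded_on_pattern. Qed.

Let GN_dist w : GG w -> `|Gsum X a w - GN w| <= r N.
Proof. by move=> Gw; rewrite GNE//; exact: G_dist. Qed.

Let EGN : EE GN = zpart a N / 4.
Proof.
rewrite /GN EE_on_pattern// ExD (Ex_cst ([ffun=> true] : {ffun 'I_(M.*2.+1).+3 -> bool})).
by rewrite Ex_run addr0.
Qed.

Let mean_dist : `|EG X a - zpart a N / 4| <= r N.
Proof. by rewrite EGE -EGN; apply: (EE_dist mGG PGG). Qed.

(** One [r N] is for the truncated sum, the other for its mean. *)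
Let centered_dist w : GG w ->
  `|(Gsum X a w - EG X a) - W (pattern X M w)| <= 2 * r N.
Proof.
move=> Gw; have h1 := GN_dist Gw; have h2 := mean_dist.
have -> : W (pattern X M w) = GN w - zpart a N / 4.
  by rewrite /GN on_patternE//; ring.
move: h1 h2; rewrite !ler_norml => /andP[? ?] /andP[? ?].
by apply/andP; split; lra.
Qed.

(** A difference of squares: [|x - y| <= 2 * r N] and [|x + y| <= 6 * l1] on the sign event. *)
Lemma var_dist : `|VarG X a - v| <= 12 * l1 * r N.
Proof.
have b1 : ess_bounded GG (fun w => Gsum X a w - EG X a).
  by apply: ess_boundedB => //; exact: ess_bounded_cst.
have -> : v = EE (on_pattern X (fun s => W s ^+ 2)).
  by rewrite EE_on_pattern// Ex_run_sqr.
rewrite VarGE; apply: (EE_dist mGG PGG).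
- by under eq_fun do rewrite expr2; exact: ess_boundedM.
- exact: ess_bounded_on_pattern.
move=> w Gw; rewrite on_patternE//.
set x := Gsum X a w - EG X a; set y := W _.
have hxy : `|x - y| <= 2 * r N by exact: centered_dist.
have hx : `|x| <= 2 * l1.
  apply: le_trans (ler_normB _ _) _; have := G_le Gw; have := EE_norm_le bG G_le.
  rewrite -EGE; lra.
have hr : r N <= l1 by rewrite gerBl sumr_ge0.
have hs : `|x + y| <= 4 * l1 + 2 * r N.
  have -> : x + y = 2 * x - (x - y) by ring.
  apply: le_trans (ler_normB _ _) _; rewrite normrM (@ger0_norm _ 2)//; lra.
rewrite subr_sqr normrM (_ : 12 * l1 * r N = (2 * r N) * (6 * l1)); last by ring.
by apply: ler_pM => //; lra.
Qed.

Lemma block_Q4 : \sum_k dM k ^+ 4 = zpart (fun i => a i ^+ 4) N / 256.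
Proof.
rewrite big_ord_recr/= [block_coef a ord_max]/block_coef ltnn expr0n addr0.
rewrite /zpart mulr_suml; apply: eq_bigr => i _.
have -> : dM (widen_ord (leqnSn _) i) = a (i%:Z - N%:Z) / 4.
  by rewrite /block_coef/= (ltn_ord i).
by field.
Qed.

Variable z : R.
Hypothesis v_gt0 : 0 < v.
Hypothesis V_gt0 : 0 < VarG X a.
Let sd := Num.sqrt (VarG X a).
Let tail := fine (P [set w | z < Fnorm X a w]).
Let pM (y : R) := Ex (fun w => (y * Num.sqrt v < W w)%R%:R : R).

Let sd_gt0 : 0 < sd. Proof. by rewrite sqrtr_gt0. Qed.
Let sv_gt0 : 0 < Num.sqrt v. Proof. by rewrite sqrtr_gt0. Qed.

Let mF : measurable [set w | z < Fnorm X a w].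
Proof.
have mF : measurable_fun [set: T] (Fnorm X a).
  by apply: measurable_funM => //; apply: measurable_funB.
have -> : [set w | z < Fnorm X a w] = Fnorm X a @^-1` `]z, +oo[.
  by apply/seteqP; split => w /=; rewrite in_itv/= andbT.
by rewrite -[X in measurable X]setTI; exact: mF.
Qed.

Let FE w : (z < Fnorm X a w) = (z * sd < Gsum X a w - EG X a).
Proof. by rewrite /Fnorm ltr_pdivlMr. Qed.

(** Lowering the threshold by the approximation error gives an inclusion of events on the sign
    event. It is measured in standard deviations of the block, as in [scaled_runs_tail]. *)
Lemma block_tail_upper : tail <= pM ((z * sd - 2 * r N) / Num.sqrt v).
Proof.
rewrite /tail -(EE_indic mGG PGG mF) /pM -(EE_on_pattern iidX).
apply: (EE_le P mGG); [exact: ess_bounded_indic|exact: ess_bounded_on_pattern|].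
move=> w Gw; rewrite on_patternE// indicE ler_nat divfK ?gt_eqF//.
have [|//] := boolP (w \in _); rewrite inE/= FE => zw.
have := centered_dist Gw; rewrite ler_norml => /andP[_ h].
by rewrite (_ : _ < _ = true)//; lra.
Qed.

Lemma block_tail_lower : pM ((z * sd + 2 * r N) / Num.sqrt v) <= tail.
Proof.
rewrite /tail -(EE_indic mGG PGG mF) /pM -(EE_on_pattern iidX).
apply: (EE_le P mGG); [exact: ess_bounded_on_pattern|exact: ess_bounded_indic|].
move=> w Gw; rewrite on_patternE// indicE ler_nat divfK ?gt_eqF//.
case: ltP => //= zw.
have := centered_dist Gw; rewrite ler_norml => /andP[h _].
by rewrite mem_set//= FE; lra.
Qed.

End block.

Let l1_ge0 : 0 <= l1. Proof. exact: le_trans (absa_le 0). Qed.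

Lemma cvg_block_var : (fun M => run_var (block_coef (M := M) a)) @ \oo --> VarG X a.
Proof.
have h : (fun M => 12 * l1 * r M.+1) @ \oo --> (0 : R).
  rewrite -(mulr0 (12 * l1)); apply: cvgMr.
  by have := cvg_r; rewrite -cvg_shiftS.
apply/cvgrPdist_le => e e0.
have /cvgrPdist_le/(_ _ e0) := h; apply: filterS => M /=.
rewrite sub0r normrN => hM; apply: le_trans (var_dist M) _.
exact: le_trans (ler_norm _) hM.
Qed.

Let a4_bound N : zpart (fun i => a i ^+ 4) N <= l1 ^+ 3 * l1.
Proof.
apply: (@le_trans _ _ (zpart (fun i => l1 ^+ 3 * absa i) N)).
  apply: zpart_le => i; rewrite -[a i ^+ 4]ger0_norm; last by rewrite (exprM _ 2 2) sqr_ge0.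
  rewrite normrX -/(absa i) exprSr ler_wpM2r//.
  by rewrite lerXn2r ?nnegrE ?absa_le.
rewrite /zpart -mulr_sumr ler_wpM2l ?exprn_ge0//.
exact: (zpart_le_zsum absa_ge0 absa_bound).
Qed.

Lemma lpnorm4E : lpnormZ 4 a ^+ 2 = Num.sqrt (zsum (fun i => a i ^+ 4)).
Proof.
have a4 i : `|a i| `^ 4 = a i ^+ 4.
  by rewrite powR_mulrn// -normrX ger0_norm// (exprM _ 2 2) sqr_ge0.
rewrite /lpnormZ; under eq_fun do rewrite a4.
rewrite -powR_mulrn ?powR_ge0// -powRrM (_ : 4^-1 * 2%:R = 2^-1); last by field.
rewrite powR12_sqrt//.
have h i : 0 <= a i ^+ 4 by rewrite (exprM _ 2 2) sqr_ge0.
exact: le_trans (sumr_ge0 _ _) (zpart_le_zsum h a4_bound 0).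
Qed.

Lemma block_Q4_le M : Num.sqrt (\sum_k block_coef (M := M) a k ^+ 4) <= lpnormZ 4 a ^+ 2 / 16.
Proof.
have h i : 0 <= a i ^+ 4 by rewrite (exprM _ 2 2) sqr_ge0.
rewrite lpnorm4E block_Q4.
have -> : (16 : R) = Num.sqrt 256 by rewrite (_ : 256 = 16 ^+ 2) ?sqrtr_sqr ?ger0_norm//; ring.
rewrite -sqrtrV// -sqrtrM; last by apply: le_trans (zpart_le_zsum h a4_bound 0); exact: sumr_ge0.
rewrite ler_sqrt; first by rewrite ler_wpM2r ?invr_ge0// (zpart_le_zsum h a4_bound).
rewrite divr_ge0//; apply: le_trans (zpart_le_zsum h a4_bound 0); exact: sumr_ge0.
Qed.

Lemma Cn_ge0 : 0 <= VarG X a -> 0 <= Cn X a.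
Proof. by move=> V0; rewrite divr_ge0// sqr_ge0. Qed.

Lemma moderate_deviation z : 0 < VarG X a -> 0 <= z -> (1 + z) ^+ 3 * Cn X a <= 2 ->
  `|fine (P [set w | z < Fnorm X a w]) - (1 - Phi z)| <=
    `|run_const : R| * (Cn X a / 16) * (1 + z) ^+ 3 * (1 - Phi z).
Proof.
move=> V0 z0 hz; set p := fine _; set C := Cn X a.
pose v M := run_var (block_coef (M := M) a).
pose sd := Num.sqrt (VarG X a); have sd0 : 0 < sd by rewrite sqrtr_gt0.
pose e M := lpnormZ 4 a ^+ 2 / 16 / v M.
(* [s = 2] and [s = - 2] give the thresholds of [block_tail_lower] and [block_tail_upper]; both
   converge to [z]. *)
pose zs (s : R) M := (z * sd + s * r M.+1) / Num.sqrt (v M).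
have cv : v @ \oo --> VarG X a := cvg_block_var.
have csv : (fun M => Num.sqrt (v M)) @ \oo --> sd.
  by apply: (cvg_comp _ _ cv); exact: sqrt_continuous.
have ce : e @ \oo --> C / 16.
  have -> : C / 16 = lpnormZ 4 a ^+ 2 / 16 / VarG X a by rewrite /C /Cn mulrAC.
  by apply: cvgM; [exact: cvg_cst|apply: cvgV => //; rewrite gt_eqF].
have czs s : zs s @ \oo --> z.
  have -> : z = (z * sd + s * 0) / sd by rewrite mulr0 addr0 mulfK// gt_eqF.
  apply: cvgM; last by apply: cvgV => //; rewrite gt_eqF.
  apply: cvgD; first exact: cvg_cst.
  by apply: cvgM; [exact: cvg_cst|have := cvg_r; rewrite -cvg_shiftS].
have cn s : (fun M => 1 + `|zs s M|) @ \oo --> 1 + z.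
  have -> : 1 + z = 1 + `|z| by rewrite ger0_norm.
  apply: cvgD; first exact: cvg_cst.
  by apply: cvg_norm; exact: czs.
have c3 s : (fun M => (1 + `|zs s M|) ^+ 3 * e M) @ \oo --> (1 + z) ^+ 3 * (C / 16).
  apply: cvgM => //; apply: (cvg_comp _ (fun x : R => x ^+ 3) (cn s)).
  exact: exprn_continuous.
have cP s : (fun M => 1 - Phi (zs s M)) @ \oo --> 1 - Phi z.
  apply: cvgB; first exact: cvg_cst.
  apply: (cvg_comp _ _ (czs s)).
  by apply: differentiable_continuous; apply/derivable1_diffP; have [] := is_derive_Phi z.
have near_bound s : \forall M \near \oo, 0 < v M /\
    `|Ex (fun w => (zs s M * Num.sqrt (v M) <
          sgn_sum (@bsgn R _) (runV (block_coef (M := M) a)) w)%R%:R)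
      - (1 - Phi (zs s M))| <=
      `|run_const : R| * ((1 + `|zs s M|) ^+ 3 * e M) * (1 - Phi (zs s M)).
  (* The limit is at most [1 / 8]; this slack yields the hypothesis [<= 1] of [scaled_runs_tail] for
     all large [M]. *)
  have lt1 : (1 + z) ^+ 3 * (C / 16) < 1 by move: hz; rewrite -/C; lra.
  near=> M.
  have vM : 0 < v M by near: M; exact: (cvgr_gt _ cv).
  have h1 : (1 + `|zs s M|) ^+ 3 * e M <= 1 by near: M; exact: (cvgr_le _ (c3 s)).
  have zm : - 1 <= zs s M by near: M; apply: (cvgr_ge _ (czs s)); lra.
  split => //; set y := zs s M in h1 zm *.
  have my : 0 <= 1 + Num.max y 0 <= 1 + `|y|.
    rewrite addr_ge0 ?le_max ?lexx ?orbT//= lerD2l ge_max ler_norm normr_ge0//.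
  have /andP[my0 my1] := my.
  pose q := Num.sqrt (\sum_k block_coef (M := M) a k ^+ 4) / v M.
  have q0 : 0 <= q by rewrite divr_ge0 ?sqrtr_ge0// ltW.
  have qe : q <= e M by rewrite ler_pM2r ?invr_gt0// block_Q4_le.
  have hq : (1 + Num.max y 0) ^+ 3 * q <= (1 + `|y|) ^+ 3 * e M.
    by apply: ler_pM => //; [exact: exprn_ge0|rewrite lerXn2r ?nnegrE// (le_trans my0)].
  apply: le_trans (scaled_runs_tail vM zm (le_trans hq h1)) _.
  rewrite ler_wpM2r ?subr_ge0 ?Phi_le1// -mulrA -/q.
  apply: (@le_trans _ _ (`|run_const : R| * (q * (1 + Num.max y 0) ^+ 3))).
    by rewrite ler_wpM2r ?ler_norm// mulr_ge0// exprn_ge0.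
  by rewrite ler_wpM2l// mulrC.
have cU s : (fun M => `|run_const : R| * ((1 + `|zs s M|) ^+ 3 * e M) *
      (1 - Phi (zs s M))) @ \oo -->
    `|run_const : R| * ((1 + z) ^+ 3 * (C / 16)) * (1 - Phi z).
  by apply: cvgM => //; apply: cvgM => //; exact: cvg_cst.
have -> : `|run_const : R| * (C / 16) * (1 + z) ^+ 3 * (1 - Phi z) =
    `|run_const : R| * ((1 + z) ^+ 3 * (C / 16)) * (1 - Phi z) by ring.
pose U s M := `|run_const : R| * ((1 + `|zs s M|) ^+ 3 * e M) * (1 - Phi (zs s M)).
have cL : (fun M => (1 - Phi (zs 2 M)) - U 2 M) @ \oo -->
    (1 - Phi z) - `|run_const : R| * ((1 + z) ^+ 3 * (C / 16)) * (1 - Phi z).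
  by apply: cvgB; [exact: cP|exact: cU].
have cH : (fun M => (1 - Phi (zs (- 2) M)) + U (- 2) M) @ \oo -->
    (1 - Phi z) + `|run_const : R| * ((1 + z) ^+ 3 * (C / 16)) * (1 - Phi z).
  by apply: cvgD; [exact: cP|exact: cU].
rewrite ler_norml; apply/andP; split.
  rewrite lerBrDl; apply: (cvgr_to_le cL); apply: filterS (near_bound 2) => M [vM].
  rewrite -/(U 2 M) ler_norml => /andP[h _].
  by have := block_tail_lower z vM V0; rewrite -/sd -/(v M) -/(zs 2 M) -/p; lra.
rewrite lerBlDl; apply: (cvgr_to_ge cH); apply: filterS (near_bound (- 2)) => M [vM].
rewrite -/(U (- 2) M) ler_norml => /andP[_ h].
by have := block_tail_upper z vM V0; rewrite -/sd -/(v M) -mulNr -/(zs (- 2) M) -/p; lra.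
Unshelve. all: end_near. Qed.

End Transfer.

Theorem theorem1p1 (R : realType) (d : measure_display) (T : measurableType d)
  (P : probability T R) (X : int -> {RV P >-> R}) (a : nat -> int -> R) :
  iid_rademacher X ->
  (forall n, summable [set: int] (fun i => (a n i)%:E)) ->
  (forall n, 0 < VarG X (a n)) ->
  exists K c : R, 0 < K /\ 0 < c /\
    forall (n : nat) (z : R),
      0 <= z ->
      z <= Num.min (Num.min (Cn X (a n) `^ (- 5^-1)) (Cn X (a n) `^ (- 3^-1)))
                   (Num.min (Cn X (a n) `^ (- (2 / 5))) (Num.sqrt (VarG X (a n)))) ->
      (1 + z ^+ 2) * gamma_n X (a n) c z <= 1 ->
      `| fine (P [set w | z < Fnorm X (a n) w]) / (1 - Phi z) - 1 |
        <= K * (1 + z ^+ 2) * gamma_n X (a n) c z.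
Proof.
(* The added 1 makes [K] positive. The exponential in [gamma_n] enters only through its lower bound
   1, so any positive [c] would serve. *)
move=> iidX sum_a V0; exists (1 + `|run_const : R|), 1.
split; first by rewrite ltr_pwDl.
split=> // n z z0 _ hz; set C := Cn X (a n).
have C0 : 0 <= C by apply: Cn_ge0; exact/ltW.
have g_ge : (1 + z) * C <= gamma_n X (a n) 1 z.
  have q0 := sqrtr_ge0 z; have q1 := mulr_ge0 q0 (sqrtr_ge0 C).
  have q2 := mulr_ge0 q0 C0; have q3 := mulr_ge0 z0 C0.
  have E1 : 1 <= expR (1 * z * (Num.sqrt (VarG X (a n)))^-1).
    by rewrite -[leLHS]expR0 ler_expR !mulr_ge0// invr_ge0 sqrtr_ge0.
  rewrite /gamma_n -/C; set S := _ * Num.sqrt C + _.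
  have S_ge : (1 + z) * C <= S by rewrite /S; lra.
  by apply: le_trans S_ge (ler_peMl _ E1); rewrite /S; lra.
set g := gamma_n X (a n) 1 z in hz g_ge *.
have zz0 : 0 <= 1 + z ^+ 2 by rewrite addr_ge0 ?sqr_ge0.
(* From [(1 + z)^2 <= 2 (1 + z^2)]. Used twice: with [hz] it gives the hypothesis [<= 2] of
   [moderate_deviation], and it converts the final rate. *)
have h3 : (1 + z) ^+ 3 * C <= 2 * ((1 + z ^+ 2) * g).
  apply: (@le_trans _ _ (2 * ((1 + z ^+ 2) * ((1 + z) * C)))); last first.
    by rewrite ler_wpM2l// ler_wpM2l.
  have q : (1 + z) ^+ 2 <= 2 * (1 + z ^+ 2) by have := sqr_ge0 (1 - z); lra.
  have := ler_wpM2r C0 (ler_wpM2r (addr_ge0 ler01 z0) q); lra.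
have P0 : 0 < 1 - Phi z by rewrite subr_gt0 Phi_lt1.
have hC : (1 + z) ^+ 3 * C <= 2 by apply: le_trans h3 _; lra.
have hm := moderate_deviation iidX (sum_a n) (V0 n) z0 hC.
rewrite -/C in hm; set p := fine _ in hm *.
have -> : p / (1 - Phi z) - 1 = (p - (1 - Phi z)) / (1 - Phi z).
  by field; rewrite gt_eqF.
have pi0 : 0 <= (1 - Phi z)^-1 by rewrite invr_ge0 ltW.
rewrite normrM (ger0_norm pi0) ler_pdivrMr//.
apply: le_trans hm _; apply: (ler_wpM2r (ltW P0)).
have k0 := normr_ge0 (run_const : R).
have g0 : 0 <= (1 + z ^+ 2) * g.
  by rewrite mulr_ge0// (le_trans _ g_ge)// mulr_ge0// addr_ge0.
have := ler_wpM2l k0 h3; have := mulr_ge0 k0 g0; lra.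
Qed.
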